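(* Suppose that the $\mathbb{R}$-valued resampling mechanism described in the context is given; in particular, $\boldsymbol S_n$ converges weakly to a random variable $\boldsymbol S$ with continuous distribution function $F$. Suppose moreover that one of the equivalent bootstrap consistency assertions (a)–(f) listed in the context holds. Let $$p_n^M=\frac1M\sum_{i=1}^M\mathbf{1}(\boldsymbol S_n^{(i)}>\boldsymbol S_n)=1-F_n^M(\boldsymbol S_n),\qquad p_n=\mathbb{P}(\boldsymbol S_n^{(1)}>\boldsymbol S_n\mid\boldsymbol X_n)=1-F_n(\boldsymbol S_n).$$ Then, as $n\to\infty$, $$p_n\leadsto\mathrm{Uniform}(0,1)\qquad\text{and}\qquad p_n^{M_n}\leadsto\mathrm{Uniform}(0,1),$$ for any sequence $M_n\to\infty$ as $n\to\infty$.
   Context: Resampling mechanism. $(\Omega,\mathcal{A},\mathbb{P})$ is a probability space. For $n\in\mathbb{N}$, $\boldsymbol X_n:\Omega\to\mathcal{X}_n$ is a random variable in some measurable space $\mathcal{X}_n$ (the data), and $\boldsymbol S_n=\boldsymbol S_n(\boldsymbol X_n)$ is a real-valued statistic. Moreover, $\boldsymbol W_n^{(i)}:\Omega\to\mathcal{W}_n$, $i\in\mathbb{N}$, are identically distributed random variables in some measurable space $\mathcal{W}_n$, and $\boldsymbol S_n^{(i)}=\boldsymbol S_n^{(i)}(\boldsymbol X_n,\boldsymbol W_n^{(i)})$, $i\in\mathbb{N}$, are real-valued statistics (to be considered as bootstrap replicates of $\boldsymbol S_n$) that are independent conditionally on $\boldsymbol X_n$. It is assumed that $\mathbb{P}(\boldsymbol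 S_n^{(1)}\in\cdot\mid\boldsymbol X_n)$ has a regular version, denoted $\mathbb{P}^{\boldsymbol S_n^{(1)}\mid\boldsymbol X_n}$, the regular conditional distribution of $\boldsymbol S_n^{(1)}$ given $\boldsymbol X_n$. Additionally, $\boldsymbol S_n$ converges weakly, as $n\to\infty$, to a random variable $\boldsymbol S$ with continuous distribution function $F$. Notation. For $n,M\in\mathbb{N}$, $x\in\mathbb{R}$: $F_n^M(x)=\frac1M\sum_{i=1}^M\mathbf{1}(\boldsymbol S_n^{(i)}\le x)$, $F_n(x)=\mathbb{P}(\boldsymbol S_n^{(1)}\le x\mid\boldsymbol X_n)$, $F(x)=\mathbb{P}(\boldsymbol S\le x)$. $\mathbb{P}^Y$ is the law of $Y$, $\leadsto$ is weak convergence, $\hat{\mathbb{P}}_M^{\boldsymbol S_n}=\frac1M\sum_{i=1}^M\delta_{\boldsymbol S_n^{(i)}}$. For probability measures $P,Q$ on $\mathbb{R}$, $d_{\mathrm{BL}}(P,Q)=\sup_f|\int f\,dP-\int f\,dQ|$, the supremum being over $f:\mathbb{R}\to[-1,1]$ with $|f(x)-f(y)|\le|x-y|$ for all $x,y$, and $d_K(P,Q)=\sup_{x\in\mathbb{R}}|P\{(-\infty,x]\}-Q\{(-\infty,x]\}|$. Limits ''as $n,M\to\infty$'' are limits of nets indexed by $(n,M)\in\mathbb{N}^2$, both indices tending to infinity. Bootstrap consistency assertions (equivalent to one another in this setting): (a) $\mathbb{P}^{(\boldsymbol S_n,\boldsymbol S_n^{(1)},\boldsymbol S_n^{(2)})}\leadsto(\mathbb{P}^{\boldsymbol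 S})^{\otimes 3}$ as $n\to\infty$; (b) $\mathbb{P}^{(\boldsymbol S_n,\boldsymbol S_n^{(1)},\dots,\boldsymbol S_n^{(M)})}\leadsto(\mathbb{P}^{\boldsymbol S})^{\otimes(M+1)}$ as $n\to\infty$, for any $M\ge2$; (c) $d_{\mathrm{BL}}(\mathbb{P}^{\boldsymbol S_n^{(1)}\mid\boldsymbol X_n},\mathbb{P}^{\boldsymbol S_n})\to0$ in probability as $n\to\infty$; (d) $d_{\mathrm{BL}}(\hat{\mathbb{P}}_M^{\boldsymbol S_n},\mathbb{P}^{\boldsymbol S_n})\to0$ in probability as $n,M\to\infty$; (e) $d_K(\mathbb{P}^{\boldsymbol S_n^{(1)}\mid\boldsymbol X_n},\mathbb{P}^{\boldsymbol S_n})\to0$ in probability as $n\to\infty$; (f) $d_K(\hat{\mathbb{P}}_M^{\boldsymbol S_n},\mathbb{P}^{\boldsymbol S_n})\to0$ in probability as $n,M\to\infty$.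
   Formalization: The replicates S_n^(i) are assumed identically distributed conditionally on X_n; identically distributed W_n^(i) alone do not suffice (take S_n^(i), i≥3, equal to a fixed function of the data independent of S_n). *)

(* Defs.v *)
From HB Require Import structures.
From mathcomp Require Import all_boot all_order all_algebra finmap.
From mathcomp Require Import all_classical all_reals all_analysis.

Set Implicit Arguments.
Unset Strict Implicit.
Unset Printing Implicit Defensive.

Import Order.TTheory GRing.Theory Num.Theory.
Import numFieldNormedType.Exports.

Local Open Scope classical_set_scope.
Local Open Scope ring_scope.

Section conditioning.
Context {R : realType} {d dX : measure_display} {Omega : measurableType d}
  {T : measurableType dX} (P : probability Omega R) (X : Omega -> T).

(* [h] is a version of the conditional probability P(E | X): it is measurable
   for the sigma-algebra generated by [X], integrable, and has the right
   integral over every event of that sigma-algebra. *)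
Definition cond_prob (E : set Omega) (h : Omega -> R) : Prop :=
  [/\ measurable_fun [set: g_sigma_algebra_preimageType X] h,
      P.-integrable [set: Omega] (EFin \o h) &
      forall C : set T, measurable C ->
        (\int[P]_(w in X @^-1` C) (h w)%:E = P (E `&` X @^-1` C))%E].

(* [kappa] is a regular version of P(Y \in . | X); the family of measures
   indexed by [Omega] is [fun w => kappa (X w)]. *)
Definition regular_cond_distr (Y : Omega -> R) (kappa : R.-pker T ~> R) : Prop :=
  forall B : set R, measurable B ->
    cond_prob (Y @^-1` B) (fun w => fine (kappa (X w) B)).

(* Conditional probabilities are defined up to almost sure equality, so
   quantifying over all versions [h] amounts to fixing one. *)
Definition cond_independent (Y : nat -> Omega -> R) : Prop :=
  forall (J : {fset nat}) (B : nat -> set R) (h : nat -> Omega -> R),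
    (forall i, measurable (B i)) ->
    (forall i, cond_prob (Y i @^-1` B i) (h i)) ->
    cond_prob (\big[setI/setT]_(i <- J) (Y i @^-1` B i))
              (fun w => \prod_(i <- J) h i w).

Definition cond_identically_distributed (Y : nat -> Omega -> R) : Prop :=
  forall (i j : nat) (B : set R) (h : Omega -> R), measurable B ->
    cond_prob (Y i @^-1` B) h -> cond_prob (Y j @^-1` B) h.

End conditioning.

Section convergence.
Context {R : realType} {d : measure_display} {Omega : measurableType d}
  (P : probability Omega R).

(* Convergence of [Y] to [0] in probability along the filter [F]. The outer
   measure agrees with [P] on measurable sets; it is used because [P] has no
   specified value on sets not yet known to be measurable. *)
Definition cvg_prob0 {I : Type} (F : set_system I) (Y : I -> Omega -> \bar R) :=
  forall e : R, 0 < e ->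
    (mu_ext P [set w | e%:E < `|Y i w|] @[i --> F] --> 0)%E.

Definition weak_cvg (Y : nat -> Omega -> R) (mu : probability R R) : Prop :=
  forall f : R -> R, continuous f -> (exists c, forall x, `|f x| <= c) ->
    (\int[P]_w (f (Y n w))%:E @[n --> \oo] --> \int[mu]_x (f x)%:E)%E.

(* Tuples carry the product sigma-algebra; the topology of R^k is that
   of row vectors. *)
Definition weak_cvg_tuple (k : nat) (Y : nat -> Omega -> k.-tuple R)
    (mu : probability (k.-tuple R) R) : Prop :=
  forall f : k.-tuple R -> R,
    continuous (fun v : 'rV[R]_k => f [tuple v 0 i | i < k]) ->
    (exists c, forall t, `|f t| <= c) ->
    (\int[P]_w (f (Y n w))%:E @[n --> \oo] --> \int[mu]_t (f t)%:E)%E.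

End convergence.

Section laws.
Context {R : realType}.

Definition tuple_cons k (xt : R * k.-tuple R) : k.+1.-tuple R :=
  [the k.+1.-tuple R of xt.1 :: xt.2].

Lemma measurable_tuple_cons k : measurable_fun [set: R * k.-tuple R] (@tuple_cons k).
Proof. by apply: measurable_cons; [exact: measurable_fst|exact: measurable_snd]. Qed.

HB.instance Definition _ k := isMeasurableFun.Build _ _ _ _ (@tuple_cons k)
  (@measurable_tuple_cons k).

(* [power_prob mu k] is the k-fold product of [mu] on R^k. *)
Fixpoint power_prob (mu : probability R R) (k : nat) : probability (k.-tuple R) R :=
  match k with
  | 0 => \d_([tuple] : 0.-tuple R)
  | k'.+1 => distribution (mu \x power_prob mu k')%E (@tuple_cons k')
  end.

Definition id_measurableTypeR : measurableTypeR R -> R := idfun.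

HB.instance Definition _ := @isMeasurableFun.Build _ _ _ _ id_measurableTypeR
  (@measurable_id _ _ setT).

(* [uniform_prob] lives on [measurableTypeR R], whose display differs from the
   one inferred for [R]; the sets and the values are unchanged. *)
Definition uniform01 : probability R R :=
  distribution (uniform_prob (@ltr01 R)) id_measurableTypeR.

Implicit Types mu nu : {measure set R -> \bar R}.

Definition d_BL mu nu : \bar R :=
  ereal_sup [set `|\int[mu]_x (f x)%:E - \int[nu]_x (f x)%:E|%E | f in
    [set f : R -> R | (forall x, `|f x| <= 1) /\
                      (forall x y, `|f x - f y| <= `|x - y|)]].

Definition d_K mu nu : \bar R :=
  ereal_sup [set `|mu `]-oo, x]%classic - nu `]-oo, x]%classic|%E | x in [set: R]].

(* Only meaningful for [0 < M]. *)
Definition empirical (y : nat -> R) (M : nat) : {measure set R -> \bar R} :=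
  mscale (M%:R^-1)%:nng (msum (fun i => \d_(y i)) M).

Definition empirical_cdf (y : nat -> R) (M : nat) (x : R) : R :=
  M%:R^-1 * \sum_(i < M) (y i <= x)%R%:R.

Definition mc_pvalue (y : nat -> R) (M : nat) (s : R) : R :=
  M%:R^-1 * \sum_(i < M) (s < y i)%R%:R.

End laws.

(* Main.v *)
(* All six consistency assertions reduce to: for every x, the conditional
   distribution function F_n(x) tends to F(x) in mean.  Smoothing indicators of
   rays by Lipschitz ramps gives this from (c) and, for the empirical measure
   along M = n, from (d); (e) and (f) are direct; (a) and (b) give
   E F_n(x) -> F(x) and E F_n(x)^2 = P(S_n^(1) <= x, S_n^(2) <= x) -> F(x)^2.
   Conditional independence makes E(F_n^M(x) - c)^2 and E(F_n(x) - c)^2 differ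
   by at most 1/M, so F_n and F_n^(M_n) are interchangeable.
   By monotonicity the pointwise convergence is uniform in x (Polya), hence
   F_n(S_n) - F(S_n) -> 0 in mean, while 1 - F(S_n) converges weakly to
   1 - F(S), which is uniform since F is continuous. *)

Require Import Defs.
From HB Require Import structures.
From mathcomp Require Import all_boot all_order all_algebra finmap ring lra.
From mathcomp Require Import all_classical all_reals all_analysis.
From mathcomp Require Import measurable_realfun.

Set Implicit Arguments.
Unset Strict Implicit.
Unset Printing Implicit Defensive.

Import Order.TTheory GRing.Theory Num.Theory.
Import numFieldNormedType.Exports.

Local Open Scope classical_set_scope.
Local Open Scope ring_scope.

(** * Bounded measurable functions *)

(** The threshold [S_ n] is a function of the same data as F_n, so convergence of F_n at each fixed
    x does not by itself control F_n(S_n). The uniform bound is pathwise, hence insensitive to this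
    dependence. Convergence in mean is the working notion because every quantity compared is bounded
    by 1: mean, mean square and probability then agree. Mean square is what joint laws and averages
    of replicates control, and integrals of measurable functions obey linear rules. The two
    distances are suprema over uncountable families; they enter only through outer measure, as upper
    bounds for measurable quantities. Both p-values are instances of one statement about random
    nonincreasing functions with values in [0,1]. An arbitrary version [p] of the conditional
    probability is brought to that form by disintegration, since a regular conditional distribution
    prescribes the probabilities of fixed Borel sets, not of rays whose endpoint depends on the
    data. *)

Section bounded_measurable.
Context {R : realType} {d : measure_display} {T : measurableType d}
  (P : probability T R).
Implicit Types f g : T -> R.

(** Under a probability this one predicate, stable under the algebraic operations, discharges the
    integrability conditions of the real-valued integrals below. *)
Definition bdd_mfun f :=
  measurable_fun [set: T] f /\ exists c, forall x, `|f x| <= c.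

Lemma bdd_mfun_integrable f : bdd_mfun f -> P.-integrable [set: T] (EFin \o f).
Proof.
move=> [mf [c fc]]; apply: measurable_bounded_integrable => //.
  by rewrite ltey_eq fin_num_measure.
exists c; split; first exact: num_real.
by move=> y cy x _; apply: le_trans (fc x) (ltW cy).
Qed.

Lemma bdd_mfunD f g : bdd_mfun f -> bdd_mfun g -> bdd_mfun (fun x => f x + g x).
Proof.
move=> [mf [a fa]] [mg [b gb]]; split; first exact: measurable_funD.
by exists (a + b) => x; rewrite (le_trans (ler_normD _ _))// lerD.
Qed.

Lemma bdd_mfunM f g : bdd_mfun f -> bdd_mfun g -> bdd_mfun (fun x => f x * g x).
Proof.
move=> [mf [a fa]] [mg [b gb]]; split; first exact: measurable_funM.
by exists (a * b) => x; rewrite normrM ler_pM.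
Qed.

Lemma bdd_mfun_cst c : bdd_mfun (fun=> c).
Proof. by split; [exact: measurable_cst|exists `|c|]. Qed.

Lemma bdd_mfunB f g : bdd_mfun f -> bdd_mfun g -> bdd_mfun (fun x => f x - g x).
Proof.
move=> bf bg; suff -> : (fun x => f x - g x) = (fun x => f x + -1 * g x).
  by apply: bdd_mfunD => //; apply: bdd_mfunM => //; exact: bdd_mfun_cst.
by apply/funext => x; rewrite mulN1r.
Qed.

Lemma bdd_mfun_norm f : bdd_mfun f -> bdd_mfun (fun x => `|f x|).
Proof.
move=> [mf [a fa]]; split; first exact: measurableT_comp.
by exists a => x; rewrite normr_id.
Qed.

Lemma bdd_mfun_sqr f : bdd_mfun f -> bdd_mfun (fun x => f x ^+ 2).
Proof. by move=> bf; exact: bdd_mfunM. Qed.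

Lemma bdd_mfun_sum (I : Type) (s : seq I) (h : I -> T -> R) :
  (forall i, bdd_mfun (h i)) -> bdd_mfun (fun x => \sum_(i <- s) h i x).
Proof.
move=> bh; elim: s => [|i s IHs].
  under [X in bdd_mfun X]eq_fun do rewrite big_nil.
  exact: bdd_mfun_cst.
under [X in bdd_mfun X]eq_fun do rewrite big_cons.
exact: bdd_mfunD.
Qed.

Lemma bdd_mfun_bool (b : T -> bool) :
  measurable_fun [set: T] b -> bdd_mfun (fun x => (b x)%:R : R).
Proof.
move=> mb; split.
  suff -> : (fun x => (b x)%:R : R) = (fun x => if b x then 1 else 0).
    exact: measurable_fun_ifT.
  by apply/funext => x; case: (b x).
by exists 1 => x; case: (b x); rewrite ?normr1 ?normr0.
Qed.

Lemma bdd_mfun_01 f : measurable_fun [set: T] f ->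
  (forall x, 0 <= f x <= 1) -> bdd_mfun f.
Proof.
by move=> mf f01; split => //; exists 1 => x; have /andP[? ?] := f01 x;
  rewrite ger0_norm.
Qed.

Lemma bdd_mfun_comp (u : R -> R) f : continuous u ->
  (exists c, forall x, `|u x| <= c) -> measurable_fun [set: T] f ->
  bdd_mfun (fun x => u (f x)).
Proof.
move=> cu [c uc] mf; split; last by exists c.
by apply: measurableT_comp => //; exact: continuous_measurable_fun.
Qed.

Lemma EFin_Rintegral f : bdd_mfun f ->
  (\int[P]_x f x)%:E = (\int[P]_x (f x)%:E)%E.
Proof.
by move=> bf; rewrite /Rintegral fineK//; apply: integrable_fin_num => //;
  exact: bdd_mfun_integrable.
Qed.

Lemma RintegralD_bdd f g : bdd_mfun f -> bdd_mfun g ->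
  \int[P]_x (f x + g x) = \int[P]_x f x + \int[P]_x g x.
Proof. by move=> bf bg; apply: RintegralD => //; exact: bdd_mfun_integrable. Qed.

Lemma RintegralB_bdd f g : bdd_mfun f -> bdd_mfun g ->
  \int[P]_x (f x - g x) = \int[P]_x f x - \int[P]_x g x.
Proof. by move=> bf bg; apply: RintegralB => //; exact: bdd_mfun_integrable. Qed.

Lemma RintegralZl_bdd c f : bdd_mfun f ->
  \int[P]_x (c * f x) = c * \int[P]_x f x.
Proof. by move=> bf; apply: RintegralZl => //; exact: bdd_mfun_integrable. Qed.

Lemma Rintegral_cst_prob c : \int[P]_(_ in [set: T]) c = c.
Proof. by rewrite Rintegral_cst// [X in fine X](probability_setT P) mulr1. Qed.

Lemma le_Rintegral_bdd f g : bdd_mfun f -> bdd_mfun g ->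
  (forall x, f x <= g x) -> \int[P]_x f x <= \int[P]_x g x.
Proof. by move=> bf bg fg; apply: le_Rintegral => //; exact: bdd_mfun_integrable. Qed.

Lemma Rintegral_sum_bdd (I : Type) (s : seq I) (h : I -> T -> R) :
  (forall i, bdd_mfun (h i)) ->
  \int[P]_x (\sum_(i <- s) h i x) = \sum_(i <- s) \int[P]_x h i x.
Proof.
move=> bh; elim: s => [|i s IHs].
  under eq_Rintegral do rewrite big_nil.
  by rewrite big_nil Rintegral_cst_prob.
under eq_Rintegral do rewrite big_cons.
rewrite RintegralD_bdd//; first by rewrite big_cons IHs.
exact: bdd_mfun_sum.
Qed.

Lemma Rintegral_bool (b : T -> bool) : measurable_fun [set: T] b ->
  \int[P]_x (b x)%:R = fine (P [set x | b x]).
Proof.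
move=> mb; rewrite /Rintegral; congr fine.
have mB : measurable [set x | b x].
  by rewrite -[X in measurable X]setTI; exact: (mb measurableT [set true]).
rewrite -[in RHS](setIT [set x | b x]) -integral_indic//.
by apply: eq_integral => x _; rewrite indicE; congr ((nat_of_bool _)%:R%:E); apply/idP/idP; rewrite inE.
Qed.

End bounded_measurable.

(** * Convergence in mean *)

Section convergence_in_mean.
Context {R : realType} {d : measure_display} {T : measurableType d}
  (P : probability T R).
Implicit Types Y Z : nat -> T -> R.

Definition cvg_mean0 Y := \int[P]_x `|Y n x| @[n --> \oo] --> 0.

Lemma cvg_mean0P Y : cvg_mean0 Y <->
  forall e, 0 < e -> \forall n \near \oo, \int[P]_x `|Y n x| <= e.
Proof.
split=> [/cvgrPdist_le Y0 e /Y0|Y0]; last apply/cvgrPdist_le => e /Y0.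
  by apply: filterS => n; rewrite sub0r normrN ger0_norm//; exact: Rintegral_ge0.
by apply: filterS => n; rewrite sub0r normrN ger0_norm//; exact: Rintegral_ge0.
Qed.

(** Integrating the bound gives E|Y| <= e + c E|Z|. The factor [c] may blow up as [e] tends to 0,
    because it is fixed before [n] grows. *)
Lemma cvg_mean0_dominated Y Z :
  (forall n, bdd_mfun (Y n)) -> (forall n, bdd_mfun (Z n)) ->
  (forall e, 0 < e -> exists2 c, 0 <= c &
     \forall n \near \oo, forall x, `|Y n x| <= e + c * `|Z n x|) ->
  cvg_mean0 Z -> cvg_mean0 Y.
Proof.
move=> bY bZ YZ Z0; apply/cvg_mean0P => e e0.
have [c c0 YcZ] := YZ _ (divr_gt0 e0 (@ltr0n R 2)).
(* [c] may be 0, so the tolerance for [Z] is divided by [c + 1]. *)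
have c1 : 0 < c + 1 by rewrite ltr_wpDl.
have e' : 0 < e / 2 / (c + 1) by rewrite !divr_gt0.
near=> n.
have Ze : \int[P]_x `|Z n x| <= e / 2 / (c + 1).
  by near: n; have /cvg_mean0P := Z0; exact.
have bcZ : bdd_mfun (fun x => c * `|Z n x|).
  by apply: bdd_mfunM; [exact: bdd_mfun_cst|exact: bdd_mfun_norm].
apply: (@le_trans _ _ (\int[P]_x (e / 2 + c * `|Z n x|))).
  apply: le_Rintegral_bdd; first exact: bdd_mfun_norm.
    by apply: bdd_mfunD => //; exact: bdd_mfun_cst.
  by near: n.
rewrite RintegralD_bdd//; last exact: bdd_mfun_cst.
rewrite Rintegral_cst_prob RintegralZl_bdd; last exact: bdd_mfun_norm.
rewrite [leRHS](splitr e) lerD2l.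
apply: (@le_trans _ _ ((c + 1) * \int[P]_x `|Z n x|)).
  by rewrite ler_wpM2r ?lerDl//; apply: Rintegral_ge0.
by rewrite mulrC -ler_pdivlMr.
Unshelve. all: by end_near. Qed.

Lemma cvg_mean0_sum (I : Type) (s : seq I) (Y : I -> nat -> T -> R) :
  (forall i n, bdd_mfun (Y i n)) -> (forall i, cvg_mean0 (Y i)) ->
  cvg_mean0 (fun n x => \sum_(i <- s) `|Y i n x|).
Proof.
move=> bY Y0; rewrite /cvg_mean0.
rewrite (_ : (fun n => _) = fun n => \sum_(i <- s) \int[P]_x `|Y i n x|).
  elim: s => [|i s IHs].
    by under eq_fun do rewrite big_nil; exact: cvg_cst.
  under eq_fun do rewrite big_cons.
  by have := cvgD (Y0 i) IHs; rewrite addr0; exact.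
apply/funext => n; rewrite -Rintegral_sum_bdd//.
  by apply: eq_Rintegral => x _; rewrite ger0_norm// sumr_ge0.
by move=> i; exact: bdd_mfun_norm.
Qed.

(** For |y| <= 1 one has y^2 <= |y|; conversely |y| <= e + y^2 / e, trivially if |y| <= e and
    because |y| / e >= 1 otherwise. *)
Lemma cvg_mean0_sqr Y : (forall n, bdd_mfun (Y n)) ->
  (forall n x, `|Y n x| <= 1) ->
  cvg_mean0 Y <-> \int[P]_x (Y n x ^+ 2) @[n --> \oo] --> 0.
Proof.
move=> bY Y1.
rewrite (_ : (fun n => _) = fun n => \int[P]_x `|Y n x ^+ 2|); last first.
  by apply/funext => n; apply: eq_Rintegral => x _; rewrite ger0_norm// sqr_ge0.
have bY2 n : bdd_mfun (fun x => Y n x ^+ 2) by exact: bdd_mfun_sqr.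
split=> [Y0|Y20].
  apply: (cvg_mean0_dominated bY2 bY _ Y0) => e e0; exists 1 => //.
  apply: nearW => n x; rewrite normrX expr2 mul1r ler_wpDl//; first exact: ltW.
  by rewrite ler_piMl.
apply: (cvg_mean0_dominated bY bY2 _ Y20) => e e0.
exists e^-1; first by rewrite invr_ge0 ltW.
apply: nearW => n x; rewrite normrX.
have := normr_ge0 (Y n x); move: `|Y n x| => y y0.
rewrite -(ler_pM2l e0) mulrDr mulrA divff ?gt_eqF// mul1r.
by have [ye|ey] := leP y e; nra.
Qed.

(** [D] may be infinite or nonmeasurable, so it is used only to cover the measurable event |Y| >
    2e/3 by the set |D| > e/(3c), of outer measure below e/3. Off that event |Y| <= 2e/3, on it |Y|
    <= 1, and the mean is at most e. *)
Lemma cvg_mean0_of_cvg_prob0 Y (D : nat -> T -> \bar R) :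
  (forall n, bdd_mfun (Y n)) -> (forall n x, `|Y n x| <= 1) ->
  cvg_prob0 P \oo D ->
  (forall e, 0 < e -> exists2 c, 0 < c &
     \forall n \near \oo, forall x, (`|Y n x|%:E <= e%:E + c%:E * `|D n x|)%E) ->
  cvg_mean0 Y.
Proof.
move=> bY Y1 D0 YD; apply/cvg_mean0P => e e0.
have e3 : 0 < e / 3 by rewrite divr_gt0.
have [c c0 YcD] := YD _ e3.
have ec : 0 < e / 3 / c by rewrite divr_gt0.
near=> n.
have : (mu_ext P [set x | ((e / 3 / c)%:E < `|D n x|)%E] < (e / 3)%:E)%E.
  near: n.
  have := D0 _ ec; move/(_ [set y | (y < (e / 3)%:E)%E]); apply.
  by apply: open_nbhs_nbhs; split; [exact: open_ereal_lt_ereal|rewrite /= lte_fin].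
move=> muD.
pose B := [set x | 2 * (e / 3) < `|Y n x|].
have mb : measurable_fun [set: T] (fun x => 2 * (e / 3) < `|Y n x|).
  apply: measurable_fun_ltr; first exact: measurable_cst.
  by have [] := bdd_mfun_norm (bY n).
have mB : measurable B.
  by rewrite -[X in measurable X]setTI; exact: (mb measurableT [set true]).
have PB : fine (P B) <= e / 3.
  rewrite -lee_fin fineK ?fin_num_measure//; apply: le_trans (ltW muD).
  rewrite -(measurable_mu_extE P mB); apply: le_mu_ext => x /=.
  rewrite /B/= => Bx; rewrite ltNge; apply/negP => Dx.
  have : (`|Y n x|%:E <= (2 * (e / 3))%:E)%E.
    have : (`|Y n x|%:E <= (e / 3)%:E + c%:E * `|D n x|)%E by move: x {Bx Dx}; near: n.
    move=> /le_trans; apply.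
    rewrite mulr_natl mulr2n EFinD leeD2lE//.
    rewrite (le_trans (lee_wpmul2l _ Dx))// ?lee_fin ?(ltW c0)//.
    by rewrite mulrC divfK// gt_eqF.
  by rewrite lee_fin leNgt Bx.
apply: (@le_trans _ _ (\int[P]_x (2 * (e / 3) + (2 * (e / 3) < `|Y n x|)%R%:R))).
  apply: le_Rintegral_bdd; first exact: bdd_mfun_norm.
    by apply: bdd_mfunD; [exact: bdd_mfun_cst|exact: bdd_mfun_bool].
  move=> x; case: ltP => [_|+].
    by rewrite (le_trans (Y1 n x))// lerDr mulr_ge0// ltW.
  by rewrite addr0.
rewrite RintegralD_bdd; [|exact: bdd_mfun_cst|exact: bdd_mfun_bool].
rewrite Rintegral_cst_prob Rintegral_bool// -/B.
lra.
Unshelve. all: by end_near. Qed.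

Lemma weak_cvg_Rintegral Y (mu : probability R R) (f : R -> R) :
  (forall n, measurable_fun [set: T] (Y n)) -> weak_cvg P Y mu ->
  continuous f -> (exists c, forall x, `|f x| <= c) ->
  \int[P]_x f (Y n x) @[n --> \oo] --> \int[mu]_x f x.
Proof.
move=> mY Ymu cf bf.
have bmf : bdd_mfun f by split => //; exact: continuous_measurable_fun.
have := Ymu f cf bf.
by rewrite -(EFin_Rintegral mu bmf) => /fine_cvg.
Qed.

(** Heine-Cantor through the near-covering form of compactness, with the radius running to 0 from
    the right. Since [f] is continuous on the whole line, [y] need not stay in [0,1]. *)
Lemma uniformly_continuous_01 (f : R -> R) (e : R) : continuous f -> 0 < e ->
  exists2 r, 0 < r & forall x y, 0 <= x <= 1 -> `|x - y| <= r ->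
    `|f x - f y| <= e.
Proof.
move=> cf e0.
have /compact_near_coveringP K := @segment_compact R 0 1.
have H : \forall r \near (0 : R)^'+, `[0, 1]%classic `<=`
    (fun x => forall y, `|x - y| <= r -> `|f x - f y| <= e).
  apply: (K R (0^'+) (fun r x => forall y, `|x - y| <= r -> `|f x - f y| <= e)).
  move=> x _.
  have /cvgrPdist_le/(_ _ (divr_gt0 e0 (@ltr0n R 2))) := cf x.
  move=> /nbhs_ballP[r /= r0 xr].
  have r2 : 0 < r / 2 by rewrite divr_gt0.
  near=> x' s => y x'y.
  have xx' : `|x - x'| < r / 2.
    by near: x'; exact: (nbhsx_ballx _ _ r2).
  have sr : s < r / 2 by near: s; exact: nbhs_right_lt.
  have fx' : `|f x - f x'| <= e / 2.
    by apply: xr; rewrite /ball/= (lt_trans xx')// ltr_pdivrMr// ltr_pMr// ltr1n.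
  have fy : `|f x - f y| <= e / 2.
    apply: xr; rewrite /ball/= (le_lt_trans (ler_distD x' _ _))// (splitr r).
    by rewrite ltrD// (le_lt_trans x'y).
  by rewrite (le_trans (ler_distD (f x) _ _))// (splitr e) lerD// distrC.
near (0 : R)^'+ => r; exists r => // x y x01 xy.
have fr : `[0, 1]%classic `<=`
    (fun x => forall y, `|x - y| <= r -> `|f x - f y| <= e) by near: r.
by apply: fr => //=; rewrite in_itv.
Unshelve. all: by end_near. Qed.

(** The test function is uniformly continuous where the variables live, which turns closeness of [Y]
    and [Z] in mean into closeness of f(Y) and f(Z) in mean. *)
Lemma weak_cvg_slutsky Y Z (mu : probability R R) :
  (forall n, measurable_fun [set: T] (Y n)) ->
  (forall n, measurable_fun [set: T] (Z n)) ->
  (forall n x, 0 <= Y n x <= 1) -> (forall n x, 0 <= Z n x <= 1) ->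
  cvg_mean0 (fun n x => Y n x - Z n x) ->
  weak_cvg P Z mu -> weak_cvg P Y mu.
Proof.
move=> mY mZ Y01 Z01 YZ Zmu f cf bf.
have bmf : bdd_mfun f by split => //; exact: continuous_measurable_fun.
have bY n : bdd_mfun (fun x => f (Y n x)) by exact: bdd_mfun_comp.
have bZ n : bdd_mfun (fun x => f (Z n x)) by exact: bdd_mfun_comp.
rewrite -(EFin_Rintegral mu bmf).
under eq_fun do rewrite -(EFin_Rintegral P (bY _)).
apply: cvg_EFin; first exact: nearW.
have Zf := weak_cvg_Rintegral mZ Zmu cf bf.
rewrite [X in X x @[x --> \oo] --> _](_ : _ =
  (fun n => \int[P]_x (f (Y n x) - f (Z n x)) + \int[P]_x f (Z n x))); last first.
  by apply/funext => n /=; rewrite RintegralB_bdd// subrK.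
rewrite -[\int[mu]_x f x]add0r; apply: cvgD => //.
apply/norm_cvg0P.
have bD n : bdd_mfun (fun x => f (Y n x) - f (Z n x)) by exact: bdd_mfunB.
have : cvg_mean0 (fun n x => f (Y n x) - f (Z n x)).
  apply: (cvg_mean0_dominated bD _ _ YZ) => [n|e e0].
    by apply: bdd_mfunB; exact: bdd_mfun_01.
  have [r r0 fr] := uniformly_continuous_01 cf e0.
  have [c fc] := bf.
  have c0 : 0 <= c by exact: le_trans (fc 0).
  (* Where |Y - Z| > r, the oscillation is at most 2c <= (2c / r) |Y - Z|. *)
  exists (2 * c / r); first by rewrite divr_ge0 ?mulr_ge0// ltW.
  apply: nearW => n x.
  have [yz|yz] := leP `|Y n x - Z n x| r.
    by rewrite ler_wpDr ?fr// mulr_ge0// divr_ge0 ?mulr_ge0// ltW.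
  rewrite ler_wpDl//; first exact: ltW.
  rewrite (@le_trans _ _ (2 * c))//.
    by rewrite (le_trans (ler_normB _ _))// mulr_natl mulr2n lerD.
  by rewrite mulrAC ler_pdivlMr// ler_wpM2l ?mulr_ge0// ltW.
move=> D0; apply: (squeeze_cvgr _ (cvg_cst 0) D0).
apply: nearW => n; rewrite normr_ge0/=.
by apply: le_normr_Rintegral => //; exact: bdd_mfun_integrable.
Qed.

End convergence_in_mean.

(** * The probability integral transform *)

Section probability_integral_transform.
Context {R : realType} {d : measure_display} {T : measurableType d}
  (P : probability T R) (X : {RV P >-> R}).
Let F x := fine (cdf X x).
Let mu : probability R R := distribution P X.
Hypothesis cF : continuous F.

Lemma fine_cdf_01 x : 0 <= F x <= 1.
Proof.
by rewrite /F -!lee_fin fineK ?fin_num_measure// cdf_ge0 cdf_le1.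
Qed.

Lemma fine_cdf_nondecreasing : nondecreasing F.
Proof.
by move=> x y xy; rewrite /F fine_le ?fin_num_measure// cdf_nondecreasing.
Qed.

Lemma fine_cdf_lt x y : F x < F y -> x < y.
Proof.
by rewrite ltNge => /negP Fyx; rewrite ltNge; apply/negP => /fine_cdf_nondecreasing.
Qed.

Lemma fine_cdf_surj c : 0 < c < 1 -> exists q, F q = c.
Proof.
move=> /andP[c0 c1].
have /cvgrPdist_lt/(_ _ c0) Na : F x @[x --> -oo] --> (0 : R).
  exact: fine_cvg (cvg_cdfNy0 X).
have c1' : 0 < 1 - c by rewrite subr_gt0.
have /cvgrPdist_lt/(_ _ c1') Nb : F x @[x --> +oo] --> (1 : R).
  exact: fine_cvg (cvg_cdfy1 X).
near (-oo : set_system R) => a; near (+oo : set_system R) => b.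
have ac : F a < c.
  have : `|0 - F a| < c by near: a.
  by rewrite sub0r normrN ger0_norm//; case/andP: (fine_cdf_01 a).
have cb : c < F b.
  have : `|1 - F b| < 1 - c by near: b.
  rewrite ger0_norm ?subr_ge0; first by rewrite ltrD2l ltrN2.
  by case/andP: (fine_cdf_01 b).
have ab : a <= b by apply: ltW; apply: fine_cdf_lt; exact: lt_trans ac cb.
have [|q _ Fq] := @IVT _ F a b c ab (continuous_subspaceT cF).
  by rewrite ge_min le_max (ltW ac) (ltW cb) orbT.
by exists q.
Unshelve. all: by end_near. Qed.

Lemma measurable_fine_cdf : measurable_fun [set: R] F.
Proof. exact: continuous_measurable_fun. Qed.

(** F(X) is uniform. No quantile function is needed: the event F < c is squeezed between lower rays
    ending at points where F takes suitable values, so flat stretches of F are harmless. *)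
Lemma probability_cdf_lt c :
  mu [set x | F x < c] = (Num.min 1 (Num.max 0 c))%:E.
Proof.
have mA : measurable [set x | F x < c].
  rewrite -[X in measurable X]setTI.
  have := @measurable_fun_ltr _ _ R setT F (cst c) measurable_fine_cdf (measurable_cst _).
  by move=> /(_ measurableT [set true]); exact.
have [c0|c0] := leP c 0.
  rewrite (_ : [set x | _] = set0) ?measure0 ?min_r//.
  apply/seteqP; split => x //= Fxc; have /andP[+ _] := fine_cdf_01 x.
  by rewrite leNgt (lt_le_trans Fxc).
have Fmu x : mu `]-oo, x]%classic = (F x)%:E by rewrite fineK// fin_num_measure.
apply/eqP; rewrite eq_le; apply/andP; split.
  have [c1|c1] := leP 1 c; first exact: probability_le1.
  have [q Fq] : exists q, F q = c by apply: fine_cdf_surj; rewrite c0.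
  rewrite -Fq -Fmu le_measure ?inE//; first by rewrite Fq.
  by move=> x /=; rewrite in_itv/= => /fine_cdf_lt/ltW.
(* The level [c] itself may exceed 1 or be attained only outside the event, so the inner ray ends
   where F equals min(1, c) - e, a value strictly between 0 and 1. *)
apply/lee_subgt0Pr => e e0; rewrite -EFinB.
have [|ec] := leP (Num.min 1 c - e) 0.
  by rewrite -lee_fin => /le_trans; apply; exact: measure_ge0.
have [q Fq] : exists q, F q = Num.min 1 c - e.
  apply: fine_cdf_surj; rewrite ec/=.
  by rewrite (@lt_le_trans _ _ (Num.min 1 c)) ?ltrBlDr ?ltrDl// ge_min lexx.
rewrite -Fq -Fmu le_measure ?inE// => x /=; rewrite in_itv/=.
move=> /fine_cdf_nondecreasing/le_lt_trans; apply; rewrite Fq.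
by rewrite (@lt_le_trans _ _ (Num.min 1 c)) ?ltrBlDr ?ltrDl// ge_min lexx orbT.
Qed.

End probability_integral_transform.

(** * The uniform law and the law of 1 - F(S) *)

Section uniform.
Context {R : realType}.

Lemma uniform01_itvoy (a : R) :
  uniform01 `]a, +oo[%classic = (Num.min 1 (Num.max 0 (1 - a)))%:E.
Proof.
have -> : uniform01 `]a, +oo[%classic = uniform_prob (@ltr01 R) `]a, +oo[%classic.
  by [].
rewrite /uniform_prob integral_uniform_pdf.
rewrite (eq_integral (cst 1%E)); last first.
  move=> x; rewrite inE/= => -[_]; rewrite in_itv/= /uniform_pdf => ->.
  by rewrite subr0 invr1.
rewrite integral_cst ?mul1e; last exact: measurableI.
have [a0|a0] := ltP a 0.
  rewrite (_ : _ `&` _ = `[0, 1]%classic).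
    rewrite [LHS](lebesgue_measure_itv `[0, 1])/= lte_fin ltr01 sube0.
    by rewrite max_r ?min_l// ?subr_ge0 ?lerDl ?oppr_ge0 ?ltW// (lt_trans a0).
  apply/seteqP; split => x /=; rewrite !in_itv/= andbT; first by case.
  by move=> x01; split => //; case/andP: x01 => /(lt_le_trans a0).
have [a1|a1] := leP 1 a.
  rewrite (_ : _ `&` _ = set0) ?measure0.
    by rewrite max_l ?subr_le0// min_r.
  apply/seteqP; split => x //=; rewrite !in_itv/= andbT => -[ax /andP[_ x1]].
  by have := lt_le_trans ax x1; rewrite ltNge a1.
rewrite (_ : _ `&` _ = `]a, 1]%classic).
  rewrite [LHS](lebesgue_measure_itv `]a, 1])/= lte_fin a1 -EFinB.
  by rewrite max_r ?subr_ge0 ?(ltW a1)// min_r// gerBl.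
apply/seteqP; split => x /=; rewrite !in_itv/= andbT.
  by move=> [-> /andP[]].
by move=> /andP[ax ->]; split => //; rewrite (le_trans a0)// ltW.
Qed.

(** Open upper rays are stable under intersection and generate the Borel sets, and those starting at
    [- n%:R] exhaust the line with finite mass. *)
Lemma eq_uniform01 (nu : {measure set R -> \bar R}) :
  (forall a, nu `]a, +oo[%classic = (Num.min 1 (Num.max 0 (1 - a)))%:E) ->
  forall A, measurable A -> nu A = uniform01 A.
Proof.
move=> nuE A mA.
apply: (measure_unique (@RGenOInfty.G R) (fun n => `](- n%:R), +oo[%classic)) => //.
- exact: RGenOInfty.measurableE.
- move=> _ _ [x ->] [y ->]; exists (Num.max x y).
  by apply/seteqP; split => z/=; rewrite !in_itv/= !andbT gt_max => /andP.
- by move=> n; exists (- n%:R).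
- apply/seteqP; split => // x _; exists (Num.truncn `|x|).+1 => //=.
  by rewrite in_itv/= andbT ltrNl (le_lt_trans (ler_norm _))// normrN truncnS_gt.
- by move=> _ [a ->]; exact: etrans (nuE a) (esym (uniform01_itvoy a)).
- by move=> n; rewrite [X in (X < _)%E](nuE (- n%:R)) ltry.
Qed.

End uniform.

Section survival_transform.
Context {R : realType} {d : measure_display} {T : measurableType d}
  (P : probability T R) (X : {RV P >-> R}).
Let F x := fine (cdf X x).
Let mu : probability R R := distribution P X.
Hypothesis cF : continuous F.

(** Change of variables: 1 - F > a means F < 1 - a, so [probability_cdf_lt] gives the mass of each
    open upper ray under the image law. *)
Lemma integral_survival_uniform01 (f : R -> R) : continuous f ->
  (exists c, forall x, `|f x| <= c) ->
  (\int[mu]_x (f (1 - F x))%:E = \int[uniform01]_x (f x)%:E)%E.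
Proof.
move=> cf bf.
have mV : measurable_fun [set: R] (fun x => 1 - F x).
  by apply: measurable_funB => //; exact: measurable_fine_cdf.
pose V : {mfun R >-> R} := HB.pack (fun x => 1 - F x)
  (isMeasurableFun.Build _ _ _ _ (fun x => 1 - F x) mV).
transitivity (\int[distribution mu V]_x (f x)%:E)%E.
  rewrite integral_distribution//.
    by apply/measurable_EFinP; exact: continuous_measurable_fun.
  by apply: bdd_mfun_integrable; exact: bdd_mfun_comp.
apply: eq_measure_integral => A mA _.
apply: eq_uniform01 => // a.
rewrite -(probability_cdf_lt cF (1 - a)); congr (P _).
by apply/seteqP; split => x /=; rewrite in_itv/= andbT ltrBrDr ltrBrDl addrC.
Qed.

End survival_transform.

(** * Random survival functions evaluated at the statistic *)

Section survival_limit.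
Context {R : realType} {d' : measure_display} {T' : measurableType d'}
  (P' : probability T' R) (X : {RV P' >-> R}).
Let F x := fine (cdf X x).
Hypothesis cF : continuous F.

(* Polya: monotonicity reduces the uniform distance to a continuous limit to
   finitely many points. *)
Lemma survival_grid (k : nat) : (0 < k)%N -> exists q : nat -> R,
  forall H : R -> R, {homo H : x y / x <= y >-> y <= x} ->
    (forall x, 0 <= H x <= 1) ->
  forall x, `|H x - (1 - F x)| <=
    2 / k%:R + \sum_(j < k) `|H (q j) - (1 - F (q j))|.
Proof.
move=> k0; have kR : 0 < k%:R :> R by rewrite ltr0n.
(* Only the levels j/k with 0 < j < k are sure to be attained. The point [q 0] is unconstrained and
   merely adds a nonnegative term to the sum. *)
have /boolp.choice[q Fq] : forall j, exists y,
    (0 < j < k)%N -> F y = j%:R / k%:R.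
  move=> j.
  have [/andP[j0 jk]|_] := boolP (0 < j < k)%N; last by exists 0.
  have [|y Fy] := @fine_cdf_surj _ _ _ P' X cF (j%:R / k%:R).
    by rewrite divr_gt0 ?ltr0n//= ltr_pdivrMr// mul1r ltr_nat.
  by exists y.
exists q => H ndH H01 x; set D := \sum_(j < k) _.
have D0 : 0 <= D by exact: sumr_ge0.
have HD j : (0 < j < k)%N -> `|H (q j) - (1 - j%:R / k%:R)| <= D.
  move=> jk; rewrite -(Fq _ jk); have /andP[_ jk'] := jk.
  by rewrite /D (bigD1 (Ordinal jk'))//= lerDl sumr_ge0.
have /andP[Fx0 Fx1] := fine_cdf_01 X x.
have /andP[Hx0 Hx1] := H01 x.
rewrite -/(F x) in Fx0 Fx1.
have /truncn_itv : 0 <= F x * k%:R by rewrite mulr_ge0// ltW.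
set i := Num.trunc _ => /andP[iF Fi].
have {}iF : i%:R / k%:R <= F x by rewrite ler_pdivrMr.
have {}Fi : F x < i.+1%:R / k%:R by rewrite ltr_pdivlMr.
have k1 : 0 < k%:R^-1 :> R by rewrite invr_gt0.
(* Here i/k <= F x < (i+1)/k. The second inequality is strict, so x lies below q_(i+1) and one grid
   step suffices for the lower bound; if i + 1 >= k, then 1 - F x <= 1/k already. *)
rewrite ler_norml; apply/andP; split.
  rewrite -(natr1 i) mulrDl mul1r in Fi.
  have [ik|ik] := ltnP i.+1 k.
    have /HD : (0 < i.+1 < k)%N by rewrite ik.
    have : H (q i.+1) <= H x.
      apply: ndH; apply: ltW; apply: (fine_cdf_lt (X := X)); rewrite -/(F x) -/(F (q i.+1)) Fq.
        by rewrite -(natr1 i) mulrDl mul1r.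
      by rewrite ik.
    rewrite -(natr1 i) mulrDl mul1r ler_norml => HH /andP[]; lra.
  have : 1 <= (i.+1)%:R / k%:R :> R by rewrite ler_pdivlMr// mul1r ler_nat.
  rewrite -(natr1 i) mulrDl mul1r; lra.
rewrite -(natr1 i) mulrDl mul1r in Fi.
(* F x may equal i/k, and equal values of F do not order the points; hence the comparison with level
   (i-1)/k and the error 2/k. For i <= 1, F x < 2/k already. *)
have [i1|i1] := ltnP 1 i.
  have i1k : (0 < i.-1 < k)%N.
    rewrite -ltnS (ltn_predK i1) i1/=.
    have : i%:R / k%:R <= 1 :> R by exact: le_trans Fx1.
    rewrite ler_pdivrMr// mul1r ler_nat; apply: leq_trans.
    by rewrite -(ltn_predK i1).
  have iE : i%:R / k%:R = i.-1%:R / k%:R + k%:R^-1 :> R.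
    by rewrite -{1}(ltn_predK i1) -natr1 mulrDl mul1r.
  have := HD _ i1k.
  have : H x <= H (q i.-1).
    apply: ndH; apply: ltW; apply: (fine_cdf_lt (X := X)).
    by rewrite -/(F x) -/(F (q i.-1)) Fq//; lra.
  rewrite ler_norml => HH /andP[]; lra.
have : i%:R / k%:R <= k%:R^-1 :> R.
  by rewrite ler_pdivrMr// mulVf ?gt_eqF// lern1.
lra.
Qed.

Context {d : measure_display} {T : measurableType d} (P : probability T R).
Variables (S_ : nat -> {RV P >-> R}) (H : nat -> T -> R -> R).
Hypothesis S_cvg : weak_cvg P S_ (distribution P' X).
Hypothesis H01 : forall n w x, 0 <= H n w x <= 1.
Hypothesis ndH : forall n w x y, x <= y -> H n w y <= H n w x.
Hypothesis mH : forall n x, measurable_fun [set: T] (fun w => H n w x).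
Hypothesis mHS : forall n, measurable_fun [set: T] (fun w => H n w (S_ n w)).
Hypothesis H_cvg : forall x, cvg_mean0 P (fun n w => H n w x - (1 - F x)).

(** [H] stands for either the conditional survival function or its Monte Carlo version. The grid
    bound holds for each outcome and all x at once, so x may be replaced by [S_ n w]; its mean
    involves only finitely many fixed points. *)
Lemma weak_cvg_survival_uniform01 :
  weak_cvg P (fun n w => H n w (S_ n w)) uniform01.
Proof.
have mF : measurable_fun [set: R] F by exact: measurable_fine_cdf.
have F01 x : 0 <= 1 - F x <= 1.
  by have := fine_cdf_01 X x; rewrite -/(F x) => /andP[? ?]; apply/andP; split; lra.
have mFS n : measurable_fun [set: T] (fun w => 1 - F (S_ n w)).
  by apply: measurable_funB => //; exact: measurableT_comp.
apply: (@weak_cvg_slutsky _ _ _ P _ (fun n w => 1 - F (S_ n w))) => //; last first.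
  move=> f cf bf; rewrite -(integral_survival_uniform01 cF cf bf).
  apply: (S_cvg (f := fun x => f (1 - F x))); last first.
    by have [c fc] := bf; exists c.
  move=> x; apply: (@continuous_comp _ _ _ (fun x => 1 - F x) f); last exact: cf.
  by apply: cvgB; [exact: cvg_cst|exact: cF].
have bd n x : bdd_mfun (fun w => H n w x - (1 - F x)).
  by apply: bdd_mfunB; [exact: bdd_mfun_01|exact: bdd_mfun_cst].
apply/cvg_mean0P => e e0.
have e4 : 0 < e / 4 by rewrite divr_gt0.
have [k k0 ke] : exists2 k, (0 < k)%N & 2 / k%:R <= e / 2 :> R.
  exists (Num.truncn (4 / e)).+1 => //.
  rewrite ler_pdivrMr// mulrAC ler_pdivlMr// -ler_pdivrMl// mulrC.
  by rewrite -natrM (le_trans _ (ltW (truncnS_gt _))).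
have [q Hq] := survival_grid k0.
have := cvg_mean0_sum (I := 'I_k) (index_enum 'I_k)
  (fun j n => bd n (q j)) (fun j => H_cvg (q j)).
move=> /cvg_mean0P/(_ _ (divr_gt0 e0 (@ltr0n R 2))).
apply: filterS => n /= sum_le.
have bs : bdd_mfun (fun w => \sum_(j < k) `|H n w (q j) - (1 - F (q j))|).
  by apply: bdd_mfun_sum => j; exact: bdd_mfun_norm.
apply: (@le_trans _ _
    (\int[P]_w (2 / k%:R + \sum_(j < k) `|H n w (q j) - (1 - F (q j))|))).
  apply: le_Rintegral_bdd.
  - by apply: bdd_mfun_norm; apply: bdd_mfunB; exact: bdd_mfun_01.
  - by apply: bdd_mfunD => //; exact: bdd_mfun_cst.
  - by move=> w; apply: Hq => // x y; exact: ndH.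
rewrite RintegralD_bdd//; last exact: bdd_mfun_cst.
rewrite Rintegral_cst_prob (splitr e) lerD//.
rewrite (le_trans _ sum_le)// le_Rintegral_bdd//; first exact: bdd_mfun_norm.
by move=> w; rewrite ler_norm.
Qed.

End survival_limit.

(** * Smoothed indicators of rays *)

Section ramp.
Context {R : realType}.
Implicit Types x e t : R.

(** For [0 < e]: 1 up to [x], 0 from [x + e], linear in between. It is continuous, hence a test
    function for weak convergence, and its slope 1/e makes it one for [d_BL] after scaling. *)
Definition ramp x e t : R := Num.max 0 (Num.min 1 ((x + e - t) / e)).

Lemma ramp_01 x e t : 0 <= ramp x e t <= 1.
Proof. by rewrite /ramp le_max lexx/= ge_max ler01 ge_min lexx. Qed.

Lemma ramp_norm_le1 x e t : `|ramp x e t| <= 1.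
Proof. by have /andP[? ?] := ramp_01 x e t; rewrite ger0_norm. Qed.

Lemma ramp_ge x e t : 0 < e -> ((t <= x)%R%:R <= ramp x e t)%R.
Proof.
move=> e0; have [tx|_] := leP t x; last by case/andP: (ramp_01 x e t).
rewrite /ramp min_l ?max_r// ler_pdivlMr// mul1r; lra.
Qed.

Lemma ramp_le x e t : 0 < e -> (ramp x e t <= (t <= x + e)%R%:R)%R.
Proof.
move=> e0; have [tx|tx] := leP t (x + e); first by case/andP: (ramp_01 x e t).
by rewrite /ramp max_l// ge_min pmulr_lle0 ?invr_gt0// subr_le0 (ltW tx) orbT.
Qed.

Lemma ramp_lipschitz x e s t : 0 < e ->
  `|ramp x e s - ramp x e t| <= e^-1 * `|s - t|.
Proof.
move=> e0.
have clamp (a b : R) :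
    `|Num.max 0 (Num.min 1 a) - Num.max 0 (Num.min 1 b)| <= `|a - b|.
  have := ler_norm (a - b); have := ler_norm (b - a); rewrite (distrC b a).
  move: `|a - b| => c ? ?; rewrite ler_norml /Order.min /Order.max.
  by do ! case: ifPn; rewrite -?leNgt => *; apply/andP; split; lra.
apply: le_trans (clamp _ _) _; rewrite -mulrBl.
have -> : x + e - s - (x + e - t) = t - s by ring.
by rewrite normrM normfV (gtr0_norm e0) mulrC distrC.
Qed.

Lemma continuous_ramp x e : 0 < e -> continuous (ramp x e).
Proof.
move=> e0 t; apply/cvgrPdist_le => r r0.
apply/nbhs_ballP; exists (e * r); first by rewrite /= mulr_gt0.
move=> s; rewrite /ball/= => ts; rewrite (le_trans (ramp_lipschitz _ _ _ e0))//.
by rewrite mulrC ler_pdivrMr// mulrC ltW.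
Qed.

Lemma bdd_mfun_ramp x e : 0 < e -> bdd_mfun (ramp x e).
Proof.
move=> e0; split.
  by apply: continuous_measurable_fun; exact: continuous_ramp.
by exists 1 => t; exact: ramp_norm_le1.
Qed.

Lemma integral_ramp_bounds (nu : {measure set R -> \bar R}) x e : 0 < e ->
  (nu `]-oo, x]%classic <= \int[nu]_t (ramp x e t)%:E <=
   nu `]-oo, (x + e)%R]%classic)%E.
Proof.
move=> e0; have [mr _] := bdd_mfun_ramp x e0.
have indicE y t : \1_(`]-oo, y]%classic) t = (t <= y)%R%:R :> R.
  by rewrite indicE mem_setE in_itv.
have nuE y : nu `]-oo, y]%classic = (\int[nu]_t (\1_(`]-oo, y]%classic) t)%:E)%E.
  by rewrite integral_indic// setIT.
rewrite !nuE; apply/andP; split; apply: ge0_le_integral => //;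
    do ?[by apply/measurable_EFinP; exact: measurable_indic
        |by apply/measurable_EFinP
        |by move=> t _; rewrite lee_fin; case/andP: (ramp_01 x e t)];
  by move=> t _; rewrite lee_fin indicE ?ramp_ge ?ramp_le.
Qed.

(** Mass at most 1, rather than exactly 1, admits [empirical y 0], which is the zero measure. *)
Lemma Rintegral_ramp_bounds (nu : {measure set R -> \bar R}) x e : 0 < e ->
  (nu [set: R] <= 1)%E ->
  fine (nu `]-oo, x]%classic) <= \int[nu]_t ramp x e t <=
  fine (nu `]-oo, (x + e)%R]%classic).
Proof.
move=> e0 nu1; have /andP[lo hi] := integral_ramp_bounds nu x e0.
have nufin y : nu `]-oo, y]%classic \is a fin_num.
  rewrite ge0_fin_numE//; apply: le_lt_trans (ltry 1).
  by apply: le_trans nu1; rewrite le_measure ?inE.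
rewrite /Rintegral.
have ifin : (\int[nu]_t (ramp x e t)%:E)%E \is a fin_num.
  rewrite ge0_fin_numE.
    by apply: le_lt_trans hi _; rewrite -ge0_fin_numE.
  by apply: integral_ge0 => t _; rewrite lee_fin; case/andP: (ramp_01 x e t).
by rewrite !fine_le.
Qed.

(** [e * ramp x e] is 1-Lipschitz, and bounded by 1 because [e <= 1]; undoing the scaling costs the
    factor 1/e. *)
Lemma d_BL_ramp (nu rho : {measure set R -> \bar R}) x e : 0 < e -> e <= 1 ->
  (nu [set: R] <= 1)%E -> (rho [set: R] <= 1)%E ->
  (`|\int[nu]_t ramp x e t - \int[rho]_t ramp x e t|%:E <=
    e^-1%:E * d_BL nu rho)%E.
Proof.
move=> e0 e1 nu1 rho1; have [mr _] := bdd_mfun_ramp x e0.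
have rint (m : {measure set R -> \bar R}) : (m [set: R] <= 1)%E ->
    m.-integrable [set: R] (EFin \o ramp x e).
  move=> m1; apply: measurable_bounded_integrable => //.
    exact: le_lt_trans m1 (ltry 1).
  exists 1; split; first exact: num_real.
  by move=> y y1 t _; apply: le_trans (ramp_norm_le1 x e t) (ltW y1).
have rE (m : {measure set R -> \bar R}) : (m [set: R] <= 1)%E ->
    (\int[m]_t (e * ramp x e t)%:E = (e * \int[m]_t ramp x e t)%:E)%E.
  move=> m1; under eq_integral do rewrite EFinM.
  rewrite integralZl//; last exact: rint.
  by rewrite EFinM /Rintegral fineK//; exact: integrable_fin_num (rint m m1).
rewrite lee_pdivlMl//.
have -> : (e%:E * `|\int[nu]_t ramp x e t - \int[rho]_t ramp x e t|%:E =
    `|\int[nu]_t (e * ramp x e t)%:E - \int[rho]_t (e * ramp x e t)%:E|)%E.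
  by rewrite !rE// -EFinB -mulrBr -EFinM /= normrM (ger0_norm (ltW e0)).
apply: ereal_sup_ubound; exists (fun t => e * ramp x e t) => //; split => [t|s t].
  by rewrite normrM (ger0_norm (ltW e0)) mulr_ile1 ?ramp_norm_le1// ltW.
rewrite -mulrBr normrM (ger0_norm (ltW e0)).
by rewrite -ler_pdivlMl// ramp_lipschitz.
Qed.

Lemma d_K_cdf (nu rho : {measure set R -> \bar R}) x :
  (nu [set: R] <= 1)%E -> (rho [set: R] <= 1)%E ->
  (`|fine (nu `]-oo, x]%classic) - fine (rho `]-oo, x]%classic)|%:E <=
    d_K nu rho)%E.
Proof.
move=> nu1 rho1.
have fin (m : {measure set R -> \bar R}) : (m [set: R] <= 1)%E ->
    m `]-oo, x]%classic \is a fin_num.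
  move=> m1; rewrite ge0_fin_numE//; apply: le_lt_trans (ltry 1).
  by apply: le_trans m1; rewrite le_measure ?inE.
apply: ereal_sup_ubound; exists x => //.
by rewrite -{1}(fineK (fin nu nu1)) -{1}(fineK (fin rho rho1)).
Qed.

End ramp.

(** * From the distances to convergence in mean *)

Section distance_to_mean.
Context {R : realType} {d' : measure_display} {T' : measurableType d'}
  (P' : probability T' R) (X : {RV P' >-> R}).
Let F x := fine (cdf X x).
Hypothesis cF : continuous F.
Context {d : measure_display} {T : measurableType d} (P : probability T R).
Variable S_ : nat -> {RV P >-> R}.
Hypothesis S_cvg : weak_cvg P S_ (distribution P' X).

(** The limiting integrals lie below F(x + r) and above F(x - r), within e/2 of F(x) for small [r];
    weak convergence costs another e/2. The width [r] is fixed before [n], and [r <= 1] suits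
    [d_BL_ramp]. *)
Lemma near_ramp_cdf x e : 0 < e -> exists2 r, 0 < r <= 1 &
  \forall n \near \oo,
    \int[distribution P (S_ n)]_t ramp x r t <= F x + e /\
    F x - e <= \int[distribution P (S_ n)]_t ramp (x - r) r t.
Proof.
move=> e0; have e2 : 0 < e / 2 by rewrite divr_gt0.
have le_hi (a b c y : R) : - (e / 2) <= b - a -> b <= c -> c <= y + e / 2 ->
  a <= y + e by lra.
have le_lo (a b c y : R) : b - a <= e / 2 -> c <= b -> y - e / 2 <= c ->
  y - e <= a by lra.
have Fx : F y @[y --> x] --> F x by exact: cF.
have /cvgrPdist_le/(_ _ e2)/nbhs_ballP[r0 /= r00 xr0] := Fx.
have [r [r_gt0 r1 rr0]] : exists r, [/\ 0 < r, r <= 1 & r < r0].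
  exists (Num.min 1 (r0 / 2)); split.
  - by rewrite lt_min ltr01 divr_gt0.
  - by rewrite ge_min lexx.
  - by rewrite gt_min [X in _ || X]ltr_pdivrMr// ltr_pMr// ltr1n orbT.
exists r; first by rewrite r_gt0.
have RE n y : \int[distribution P (S_ n)]_t ramp y r t =
    \int[P]_w ramp y r (S_ n w).
  rewrite /Rintegral; congr fine; apply: integral_distribution.
    by apply/measurable_EFinP; case: (bdd_mfun_ramp y r_gt0).
  apply: bdd_mfun_integrable; apply: bdd_mfun_comp => //.
    exact: continuous_ramp.
  by exists 1 => t; exact: ramp_norm_le1.
have cv y : \int[P]_w ramp y r (S_ n w) @[n --> \oo] -->
    \int[distribution P' X]_t ramp y r t.
  apply: weak_cvg_Rintegral => //; first exact: continuous_ramp.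
  by exists 1 => t; exact: ramp_norm_le1.
have mu1 : (distribution P' X [set: R] <= 1)%E by exact: probability_le1.
have /andP[_ hi] := Rintegral_ramp_bounds x r_gt0 mu1.
have /andP[lo _] := Rintegral_ramp_bounds (x - r) r_gt0 mu1.
have Fhi : F (x + r) <= F x + e / 2.
  have : `|F x - F (x + r)| <= e / 2.
    by apply: xr0; rewrite /ball/= opprD addNKr normrN gtr0_norm.
  by rewrite ler_norml => /andP[? _]; lra.
have Flo : F x - e / 2 <= F (x - r).
  have : `|F x - F (x - r)| <= e / 2.
    by apply: xr0; rewrite /ball/= opprB addrC subrK gtr0_norm.
  by rewrite ler_norml => /andP[_ ?]; lra.
have /cvgrPdist_le/(_ _ e2) := cv x.
have /cvgrPdist_le/(_ _ e2) := cv (x - r).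
apply: filterS2 => n; rewrite -!RE !ler_norml => /andP[_ nlo] /andP[nhi _].
split; [exact: le_hi nhi hi Fhi|exact: le_lo nlo lo Flo].
Qed.

Variable nu : nat -> T -> {measure set R -> \bar R}.
Hypothesis nu1 : forall n w, (nu n w [set: R] <= 1)%E.
Hypothesis mnu : forall n x,
  measurable_fun [set: T] (fun w => fine (nu n w `]-oo, x]%classic)).

Lemma fine_ray_01 n w x : 0 <= fine (nu n w `]-oo, x]%classic) <= 1.
Proof.
have nuray : (nu n w `]-oo, x]%classic <= 1)%E.
  by apply: le_trans (nu1 n w); rewrite le_measure ?inE.
rewrite fine_ge0//= -lee_fin fineK// ge0_fin_numE//.
exact: le_lt_trans nuray (ltry 1).
Qed.

Lemma dist_cdf_le1 n w x : `|fine (nu n w `]-oo, x]%classic) - F x| <= 1.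
Proof.
have /andP[? ?] := fine_ray_01 n w x; have /andP[? ?] := fine_cdf_01 X x.
by rewrite ler_norml; rewrite /F; apply/andP; split; lra.
Qed.

Lemma bdd_mfun_dist_cdf n x :
  bdd_mfun (fun w => fine (nu n w `]-oo, x]%classic) - F x).
Proof.
apply: bdd_mfunB; last exact: bdd_mfun_cst.
by apply: bdd_mfun_01 => // w; exact: fine_ray_01.
Qed.

(** The ramps at [x] and at [x - r] enclose the indicator of the ray ending at [x]. Passing from
    [nu] to the law of [S_ n] costs d_BL / r, and the ramp integrals under that law are within e of
    F(x) on the relevant sides. *)
Lemma cvg_mean0_cdf_of_d_BL :
  cvg_prob0 P \oo (fun n w => d_BL (nu n w) (distribution P (S_ n))) ->
  forall x, cvg_mean0 P (fun n w => fine (nu n w `]-oo, x]%classic) - F x).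
Proof.
move=> D0 x; apply: (cvg_mean0_of_cvg_prob0 _ _ D0) => [n|n w|e e0].
- exact: bdd_mfun_dist_cdf.
- exact: dist_cdf_le1.
have bound_hi (a b c y D : R) : a - b <= D -> c <= a -> b <= y + e ->
  c - y <= e + D by lra.
have bound_lo (a b c y D : R) : - D <= a - b -> a <= c -> y - e <= b ->
  - (e + D) <= c - y by lra.
have [r /andP[r0 r1] near_r] := near_ramp_cdf x e0.
exists r^-1; first by rewrite invr_gt0.
apply: filterS near_r => n [hi lo] w.
set rho : probability R R := distribution P (S_ n) in hi lo *.
have rho1 : (rho [set: R] <= 1)%E by exact: probability_le1.
have := d_BL_ramp x r0 r1 (nu1 n w) rho1.
have := d_BL_ramp (x - r) r0 r1 (nu1 n w) rho1.
have D_ge0 : (0 <= d_BL (nu n w) rho)%E.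
  apply: ereal_sup_ubound; exists (fun=> 0); last by rewrite !integral0_eq// sube0 abse0.
  by split=> [y|y z]; rewrite ?subrr normr0.
rewrite gee0_abs//; case: (d_BL _ _) D_ge0 => [D|_ _ _|//].
  rewrite -EFinM -EFinD !lee_fin => D0' lo' hi'.
  have /andP[nulo _] := Rintegral_ramp_bounds x r0 (nu1 n w).
  have /andP[_ nuhi] := Rintegral_ramp_bounds (x - r) r0 (nu1 n w).
  rewrite subrK in nuhi.
  move: lo' hi'; rewrite !ler_norml => /andP[lo1 lo2] /andP[hi1 hi2].
  by apply/andP; split; [exact: bound_lo lo1 nuhi lo|exact: bound_hi hi2 nulo hi].
(* The value +oo of the distance has not been excluded; it makes the bound trivial. *)
by rewrite gt0_muley ?lte_fin ?invr_gt0// addey// leey.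
Qed.

Lemma cvg_mean0_cdf_of_d_K :
  cvg_prob0 P \oo (fun n w => d_K (nu n w) (distribution P (S_ n))) ->
  forall x, cvg_mean0 P (fun n w => fine (nu n w `]-oo, x]%classic) - F x).
Proof.
move=> D0 x; apply: (cvg_mean0_of_cvg_prob0 _ _ D0) => [n|n w|e e0].
- exact: bdd_mfun_dist_cdf.
- exact: dist_cdf_le1.
have [r /andP[r0 r1] near_r] := near_ramp_cdf x e0.
exists 1 => //; apply: filterS near_r => n [hi lo] w.
set rho : probability R R := distribution P (S_ n) in hi lo *.
have rho1 : (rho [set: R] <= 1)%E by exact: probability_le1.
rewrite mul1e; have := d_K_cdf x (nu1 n w) rho1.
move=> D; apply: (@le_trans _ _ (e%:E +
    `|fine (nu n w `]-oo, x]%classic) - fine (rho `]-oo, x]%classic)|%:E)%E).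
  have /andP[nulo _] := Rintegral_ramp_bounds x r0 rho1.
  have /andP[_ nuhi] := Rintegral_ramp_bounds (x - r) r0 rho1.
  rewrite subrK in nuhi.
  rewrite -EFinD lee_fin (le_trans (ler_distD (fine (rho `]-oo, x]%classic)) _ _))//.
  rewrite addrC lerD2r ler_norml.
  by rewrite lerBlDl lerBrDl (le_trans nulo hi) (le_trans lo nuhi).
by rewrite leeD2lE// (le_trans D)// gee0_abs// (le_trans _ D).
Qed.

End distance_to_mean.

(** * Product measures and joint convergence *)

Section power_prob_theory.
Context {R : realType} (mu : probability R R).

(** Sides indexed by [nat] let an induction on [k] pass to the shifted sequence without recasting
    ordinals. *)
Definition box k (B : nat -> set R) : set (k.-tuple R) :=
  [set t | forall i : 'I_k, B i (tnth t i)].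

Lemma measurable_box k (B : nat -> set R) : (forall i, measurable (B i)) ->
  measurable (box (k := k) B).
Proof.
move=> mB; have -> : box B =
    \big[setI/setT]_(i < k) ((fun t : k.-tuple R => tnth t i) @^-1` B i).
  apply/seteqP; split => t.
    by move=> Bt; rewrite -bigcap_seq => i _; exact: Bt.
  by rewrite -bigcap_seq => Bt i; apply: Bt; rewrite /= mem_index_enum.
apply: bigsetI_measurable => i _; rewrite -[X in measurable X]setTI.
by apply: measurable_tnth.
Qed.

Lemma power_prob_box k (B : nat -> set R) : (forall i, measurable (B i)) ->
  power_prob mu k (box B) = (\prod_(i < k) mu (B i))%E.
Proof.
elim: k B => [|k IHk] B mB.
  rewrite big_ord0 /= diracE (_ : _ \in _)//; apply/mem_set => -[] //.
rewrite big_ord_recl/=.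
rewrite -(IHk (fun i => B i.+1))// -product_measure1E//; last exact: measurable_box.
congr ((mu \x power_prob mu k)%E _).
apply/seteqP; split => -[y t] /=.
  move=> Bt; split => [|i /=]; first exact: (Bt ord0).
  by have := Bt (lift ord0 i); rewrite tnthS.
move=> [By Bt] i; have [j ->|->] := unliftP ord0 i; last exact: By.
by rewrite /= tnthS; exact: Bt.
Qed.

End power_prob_theory.

(** * Joint weak convergence and joint distribution functions *)

Section tuple_limit.
Context {R : realType} {d' : measure_display} {T' : measurableType d'}
  (P' : probability T' R) (X : {RV P' >-> R}).
Let F x := fine (cdf X x).
Hypothesis cF : continuous F.
Context {d : measure_display} {T : measurableType d} (P : probability T R).

Lemma bdd_mfun_prod (d0 : measure_display) (T0 : measurableType d0) (I : Type)
    (s : seq I) (A : pred I) (h : I -> T0 -> R) :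
  (forall i, bdd_mfun (h i)) -> bdd_mfun (fun x => \prod_(i <- s | A i) h i x).
Proof.
move=> bh; elim: s => [|i s IHs].
  under [X in bdd_mfun X]eq_fun do rewrite big_nil.
  exact: bdd_mfun_cst.
under [X in bdd_mfun X]eq_fun do rewrite big_cons.
by case: (A i) => //; exact: bdd_mfunM.
Qed.

Lemma continuous_prod (U : topologicalType) (I : Type)
    (s : seq I) (A : pred I) (h : I -> U -> R) :
  (forall i, continuous (h i)) -> continuous (fun x => \prod_(i <- s | A i) h i x).
Proof.
move=> ch; elim: s => [|i s IHs] x.
  under eq_fun do rewrite big_nil; exact: cvg_cst.
under eq_fun do rewrite big_cons.
case: (A i); last exact: IHs.
by apply: cvgM; [exact: ch|exact: IHs].
Qed.

Lemma Rintegral_power_prob_ramp k (A : {set 'I_k}) x e : 0 < e ->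
  F x ^+ #|A| <=
  \int[power_prob (distribution P' X) k]_t \prod_(i in A) ramp x e (tnth t i) <=
  F (x + e) ^+ #|A|.
Proof.
move=> e0; set mu := distribution P' X.
pose b y (t : k.-tuple R) := [forall i in A, tnth t i <= y].
have bE y t : (b y t)%:R = \prod_(i in A) (tnth t i <= y)%R%:R :> R.
  have [/forall_inP byt|/forall_inPn[i iA it]] := boolP (b y t).
    by rewrite big1// => i /byt ->.
  by rewrite (bigD1 i)//= (negbTE it) mul0r.
have mt (i : 'I_k) : measurable_fun setT (fun t : k.-tuple R => tnth t i).
  exact: measurable_tnth.
have bdb y : bdd_mfun (fun t : k.-tuple R => (b y t)%:R : R).
  rewrite (_ : (fun _ => _) = fun t => \prod_(i in A) (tnth t i <= y)%R%:R); last first.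
    by apply/funext => t; rewrite bE.
  apply: bdd_mfun_prod => i; apply: bdd_mfun_bool.
  by apply: measurable_fun_ler => //; exact: measurable_cst.
have bdr : bdd_mfun (fun t : k.-tuple R => \prod_(i in A) ramp x e (tnth t i)).
  apply: bdd_mfun_prod => i; apply: bdd_mfun_comp => //.
    exact: continuous_ramp.
  by exists 1 => t; exact: ramp_norm_le1.
have ib y : \int[power_prob mu k]_t (b y t)%:R = F y ^+ #|A|.
  (* Coordinates outside [A] get the whole line, which contributes the factor 1. *)
  pose B (j : nat) := if j \in [seq nat_of_ord i | i in A] then `]-oo, y]%classic else setT.
  have BE (i : 'I_k) : B i = if i \in A then `]-oo, y]%classic else setT.
    by rewrite /B (fintype.mem_image (@ord_inj k)).
  have mB i : measurable (B i) by rewrite /B; case: ifPn.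
  transitivity (\int[power_prob mu k]_t \1_(box B) t).
    apply: eq_Rintegral => t _; rewrite indicE; congr (nat_of_bool _)%:R.
    apply/forall_inP/idP => [byt|].
      apply/mem_set => i; rewrite BE; case: ifPn => // iA /=.
      by rewrite in_itv/= byt.
    rewrite inE => Bt i iA; have := Bt i; rewrite BE iA /= in_itv/=; exact.
  rewrite /Rintegral integral_indic// ?setIT; last exact: measurable_box.
  rewrite [X in fine X]power_prob_box//.
  rewrite (eq_bigr (fun i : 'I_k => (if i \in A then F y else 1)%:E)).
    by rewrite prodEFin/= -big_mkcond/= prodr_const.
  move=> i _; rewrite BE; case: ifPn => _; last exact: probability_setT.
  by rewrite fineK// fin_num_measure.
by rewrite -!ib; apply/andP; split; apply: le_Rintegral_bdd => // t;
  rewrite bE; apply: ler_prod => i _; rewrite ?ramp_le ?ramp_ge ?ler0n ?andbT;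
  case/andP: (ramp_01 x e (tnth t i)).
Qed.

(** Indicators of orthants are discontinuous, so they are enclosed between products of ramps, and
    continuity of F^|A| closes the gap. Choosing [A] extracts first and second moments of F_n from
    one joint law. *)
Lemma cvg_joint_cdf k (Y : nat -> T -> k.-tuple R) (A : {set 'I_k}) x :
  (forall n, measurable_fun [set: T] (Y n)) ->
  weak_cvg_tuple P Y (power_prob (distribution P' X) k) ->
  \int[P]_w (\prod_(i in A) (tnth (Y n w) i <= x)%R%:R) @[n --> \oo] -->
    F x ^+ #|A|.
Proof.
move=> mY Ymu; set mu := distribution P' X in Ymu.
pose f y r (t : k.-tuple R) := \prod_(i in A) ramp y r (tnth t i).
have mt (i : 'I_k) : measurable_fun setT (fun t : k.-tuple R => tnth t i).
  exact: measurable_tnth.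
have bdr y r : 0 < r -> bdd_mfun (f y r).
  move=> r0; apply: bdd_mfun_prod => i; apply: bdd_mfun_comp => //.
    exact: continuous_ramp.
  by exists 1 => t; exact: ramp_norm_le1.
have bdrY y r n : 0 < r -> bdd_mfun (fun w => f y r (Y n w)).
  move=> r0; have [mf [c fc]] := bdr y r r0; split; last by exists c.
  exact: measurableT_comp.
have cvf y r : 0 < r -> \int[P]_w f y r (Y n w) @[n --> \oo] -->
    \int[power_prob mu k]_t f y r t.
  move=> r0; have : (\int[P]_w (f y r (Y n w))%:E @[n --> \oo] -->
      \int[power_prob mu k]_t (f y r t)%:E)%E.
    apply: Ymu; last by case: (bdr y r r0).
    rewrite /f; under eq_fun do under eq_bigr do rewrite tnth_mktuple.
    apply: continuous_prod => i v.
    apply: (@continuous_comp _ _ _ (fun u : 'rV[R]_k => u 0 i) (ramp y r)).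
      exact: coord_continuous.
    exact: continuous_ramp.
  by rewrite -(EFin_Rintegral (power_prob mu k) (bdr y r r0)) => /fine_cvg.
have bdi n : bdd_mfun (fun w => \prod_(i in A) (tnth (Y n w) i <= x)%R%:R : R).
  apply: bdd_mfun_prod => i; apply: bdd_mfun_bool.
  apply: measurable_fun_ler; last exact: measurable_cst.
  by apply: (measurableT_comp (mt i)).
apply/cvgrPdist_le => e e0; have e2 : 0 < e / 2 by rewrite divr_gt0.
have le_hi (a b c y : R) : - (e / 2) <= b - a -> b <= c -> c <= y + e / 2 ->
  a <= y + e by lra.
have le_lo (a b c y : R) : b - a <= e / 2 -> c <= b -> y - e / 2 <= c ->
  y - e <= a by lra.
have dist_le (a b : R) : a <= b + e -> b - e <= a -> `|b - a| <= e.
  by move=> ? ?; rewrite ler_norml; apply/andP; split; lra.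
have FA : F y ^+ #|A| @[y --> x] --> F x ^+ #|A|.
  by apply: (@continuous_comp _ _ _ F (fun z => z ^+ #|A|));
    [exact: cF|exact: exprn_continuous].
have /cvgrPdist_le/(_ _ e2)/nbhs_ballP[r0 /= r00 xr0] := FA.
have [r r_gt0 rr0] : exists2 r, 0 < r & r < r0.
  by exists (r0 / 2); rewrite ?divr_gt0// ltr_pdivrMr// ltr_pMr// ltr1n.
have Fhi : F (x + r) ^+ #|A| <= F x ^+ #|A| + e / 2.
  have := xr0 (x + r); rewrite /ball/= opprD addNKr normrN gtr0_norm//.
  by move=> /(_ rr0); rewrite ler_distlC => /andP[].
have Flo : F x ^+ #|A| - e / 2 <= F (x - r) ^+ #|A|.
  have := xr0 (x - r); rewrite /ball/= opprB addrC subrK gtr0_norm//.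
  by move=> /(_ rr0); rewrite ler_distlC => /andP[].
have /andP[_ hi] := Rintegral_power_prob_ramp A x r_gt0.
have /andP[lo _] := Rintegral_power_prob_ramp A (x - r) r_gt0.
have /cvgrPdist_le/(_ _ e2) := cvf x r r_gt0.
have /cvgrPdist_le/(_ _ e2) := cvf (x - r) r r_gt0.
apply: filterS2 => n; rewrite !ler_norml => /andP[_ nlo] /andP[nhi _].
rewrite -ler_norml; apply: dist_le.
  apply: le_trans (le_hi _ _ _ _ nhi hi Fhi); apply: le_Rintegral_bdd => //.
    exact: bdrY.
  by move=> w; apply: ler_prod => i _; rewrite ler0n ramp_ge.
apply: le_trans (le_lo _ _ _ _ nlo lo Flo) _; apply: le_Rintegral_bdd => //.
  exact: bdrY.
move=> w; apply: ler_prod => i _.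
case/andP: (ramp_01 (x - r) r (tnth (Y n w) i)) => -> _ /=.
by have := ramp_le (x - r) (tnth (Y n w) i) r_gt0; rewrite subrK.
Qed.

End tuple_limit.

(** * Conditional probabilities *)

Section conditional_probability.
Context {R : realType} {d dX : measure_display} {Omega : measurableType d}
  {T : measurableType dX} (P : probability Omega R) (X : {RV P >-> T}).

Lemma measurable_fun_preimage (d1 : measure_display) (U : measurableType d1)
    (phi : T -> U) : measurable_fun [set: T] phi ->
  measurable_fun [set: g_sigma_algebra_preimageType X] (fun w => phi (X w)).
Proof.
move=> mphi _ B mB; exists (phi @^-1` B); last by rewrite !setTI.
by rewrite -[X in measurable X]setTI; exact: mphi.
Qed.

Lemma measurable_fun_sub_preimage (d1 : measure_display) (U : measurableType d1)
    (h : Omega -> U) :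
  measurable_fun [set: g_sigma_algebra_preimageType X] h ->
  measurable_fun [set: Omega] h.
Proof.
move=> mh _ B mB; have [C mC] := mh measurableT B mB.
by rewrite !setTI => <-; rewrite -[X in measurable X]setTI; exact: measurable_funPT.
Qed.

Lemma Rintegral_cond_prob E h : cond_prob P X E h ->
  \int[P]_w h w = fine (P E).
Proof.
move=> [_ _ /(_ setT measurableT)]; rewrite preimage_setT setIT /Rintegral => ->.
by [].
Qed.

(** The event h2 < h1 lies in the sigma-algebra of [X], so both versions have the same integral over
    it. There h1 - h2 is positive with integral 0, and the event is null. *)
Lemma cond_prob_ae_le E h1 h2 : measurable E ->
  cond_prob P X E h1 -> cond_prob P X E h2 ->
  {ae P, forall w, h1 w <= h2 w}.
Proof.
move=> mE [m1 i1 e1] [m2 i2 e2].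
have mlt := @measurable_fun_ltr _ (g_sigma_algebra_preimageType X) R setT _ _ m2 m1.
have [C mC] := mlt measurableT [set true] I.
rewrite !setTI => CE; set A := X @^-1` C in CE.
have mA : measurable A by rewrite -[X in measurable X]setTI; exact: measurable_funPT.
have AE w : A w = (h2 w < h1 w)%R by rewrite CE /=; exact/propext.
have s1 : P.-integrable A (EFin \o h1) by exact: integrableS i1.
have s2 : P.-integrable A (EFin \o h2) by exact: integrableS i2.
have mD : measurable_fun A (fun w => (h1 w - h2 w)%:E).
  apply/measurable_EFinP; apply: measurable_funS measurableT _ _ => //.
  by apply: measurable_funB; exact: measurable_fun_sub_preimage.
have : (\int[P]_(w in A) `|(h1 w - h2 w)%:E| = 0)%E.
  rewrite (eq_integral (fun w => (h1 w)%:E - (h2 w)%:E)%E).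
    rewrite integralB_EFin// e1// e2// subee// fin_num_measure//.
    exact: measurableI.
  move=> w; rewrite inE AE => h12.
  by rewrite gee0_abs ?EFinB// lee_fin subr_ge0 ltW.
move=> /(ae_eq_integral_abs P mA mD).
apply: filterS => w; rewrite AE => h12; rewrite leNgt; apply/negP => hlt.
by have [/eqP] := h12 hlt; rewrite subr_eq0 => /eqP h; move: hlt; rewrite h ltxx.
Qed.

Lemma cond_prob_ae_eq E h1 h2 : measurable E ->
  cond_prob P X E h1 -> cond_prob P X E h2 ->
  {ae P, forall w, h1 w = h2 w}.
Proof.
move=> mE c1 c2; have := cond_prob_ae_le mE c1 c2.
apply: filterS2 (cond_prob_ae_le mE c2 c1) => w h21 h12.
by apply/eqP; rewrite eq_le h12 h21.
Qed.

End conditional_probability.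

(** * Disintegration of the joint law of data and replicate *)

Section disintegration.
Context {R : realType} {d dX : measure_display} {Omega : measurableType d}
  {T : measurableType dX} (P : probability Omega R) (X : {RV P >-> T})
  (kappa : R.-pker T ~> R).

Lemma measurable_kernel_xsection (A : set (T * R)) : measurable A ->
  measurable_fun [set: T] (fun x => kappa x (xsection A x)).
Proof. by move=> mA; apply: measurable_fun_xsection_finite_kernel; rewrite inE. Qed.

Lemma pkernel_le1 x (B : set R) : measurable B -> (kappa x B <= 1)%E.
Proof. by move=> mB; rewrite -(prob_kernel (s := kappa) x) le_measure ?inE. Qed.

Lemma pkernel_fin_num x (B : set R) : measurable B -> kappa x B \is a fin_num.
Proof.
move=> mB; rewrite ge0_fin_numE//.
exact: le_lt_trans (pkernel_le1 x mB) (ltry 1).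
Qed.

(** The joint law of (X, Y) rebuilt from the kernel. Making it a measure gives access to uniqueness
    of measures. *)
Definition kernel_joint (A : set (T * R)) : \bar R :=
  (\int[P]_w kappa (X w) (xsection A (X w)))%E.

Let kernel_joint0 : kernel_joint set0 = 0%E.
Proof. by rewrite /kernel_joint integral0_eq// => w _; rewrite xsection0. Qed.

Let kernel_joint_ge0 A : (0 <= kernel_joint A)%E.
Proof. exact: integral_ge0. Qed.

Let kernel_joint_sigma_additive : semi_sigma_additive kernel_joint.
Proof.
move=> A mA tA mbigA; apply: cvg_toP.
  apply: ereal_nondecreasing_is_cvgn => m n mn.
  exact: lee_sum_nneg_natr.
rewrite -integral_nneseries//; last first.
  by move=> n; exact: measurableT_comp (measurable_kernel_xsection (mA n)) _.
apply: eq_integral => w _; rewrite xsection_bigcup.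
rewrite measure_bigcup//; last exact: trivIset_xsection.
  by apply: eq_eseriesl => n; rewrite in_setT.
by move=> i _; exact: measurable_xsection.
Qed.

HB.instance Definition _ := isMeasure.Build _ _ _ kernel_joint
  kernel_joint0 kernel_joint_ge0 kernel_joint_sigma_additive.

Variable Y : {RV P >-> R}.
Hypothesis kappaY : regular_cond_distr P X Y kappa.

(** On a rectangle this is the defining property of the regular conditional distribution, and
    measurable rectangles form a generating class stable under intersection. *)
Lemma kernel_jointE (A : set (T * R)) : measurable A ->
  kernel_joint A = P [set w | A (X w, Y w)].
Proof.
move=> mA.
have mXY : measurable_fun [set: Omega] (fun w => (X w, Y w)).
  by apply: measurable_fun_pair.
pose XY : {mfun Omega >-> (T * R)%type} := HB.pack (fun w => (X w, Y w))
  (isMeasurableFun.Build _ _ _ _ (fun w => (X w, Y w)) mXY).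
pose G : set (set (T * R)) := [set C `*` B | C in measurable & B in measurable].
apply/esym.
apply: (measure_unique G (fun=> setT) _ _ _ _ (distribution P XY) kernel_joint) => //.
- by rewrite measurable_prod_measurableType.
- move=> _ _ [C1 mC1 [B1 mB1 <-]] [C2 mC2 [B2 mB2 <-]].
  exists (C1 `&` C2); first exact: measurableI.
  by exists (B1 `&` B2); [exact: measurableI|rewrite setXI].
- by move=> _; exists setT => //; exists setT => //; rewrite setXTT.
- by rewrite bigcup_const.
- move=> _ [C mC [B mB <-]].
  have [_ _ /(_ C mC) e] := kappaY mB.
  transitivity (P (Y @^-1` B `&` X @^-1` C)).
    by congr (P _); apply/seteqP; split => w [].
  rewrite -e integral_mkcond; apply: eq_integral => w _.
  rewrite patchE; case: ifPn => wC.
    rewrite in_xsectionX; first by rewrite fineK ?pkernel_fin_num.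
    by move: wC; rewrite !inE.
  by rewrite notin_xsectionX ?measure0.
- by move=> _; rewrite ltey_eq fin_num_measure.
Qed.

(** Freezing the data: conditionally on [X], an event about (X, Y) becomes the section of [A] at the
    observed value. This admits thresholds that depend on the data. *)
Lemma cond_prob_kernel_xsection (A : set (T * R)) : measurable A ->
  cond_prob P X [set w | A (X w, Y w)]
    (fun w => fine (kappa (X w) (xsection A (X w)))).
Proof.
move=> mA; have mf : measurable_fun [set: T] (fun x => fine (kappa x (xsection A x))).
  by apply: measurableT_comp => //; exact: measurable_kernel_xsection.
split; first exact: measurable_fun_preimage mf.
  apply: bdd_mfun_integrable; apply: bdd_mfun_01 => [|w].
    exact: measurableT_comp mf _.
  have mAw := measurable_xsection (X w) mA.
  by rewrite fine_ge0//= -lee_fin fineK ?pkernel_fin_num// pkernel_le1.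
move=> C mC.
have mCT : measurable (C `*` [set: R]) by exact: measurableX.
(* Restricting the integral to X in C amounts to intersecting [A] with a cylinder. *)
transitivity (kernel_joint (A `&` C `*` setT)).
  rewrite /kernel_joint integral_mkcond; apply: eq_integral => w _.
  rewrite patchE xsectionI; case: ifPn => wC.
    rewrite in_xsectionX; last by move: wC; rewrite !inE.
    by rewrite setIT fineK// pkernel_fin_num//; exact: measurable_xsection.
  by rewrite notin_xsectionX ?setI0 ?measure0.
rewrite kernel_jointE; last exact: measurableI.
by congr (P _); apply/seteqP; split => w /=; tauto.
Qed.

End disintegration.

(** * Monte Carlo averages *)

Section second_moments.
Context {R : realType} {d : measure_display} {T : measurableType d}
  (P : probability T R).

Section averages.
Variables (b : nat -> T -> R) (f : T -> R).
Hypothesis bb : forall i, bdd_mfun (b i).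
Hypothesis b_idem : forall i x, b i x * b i x = b i x.
Hypothesis mf : measurable_fun [set: T] f.
Hypothesis f01 : forall x, 0 <= f x <= 1.
Hypothesis Eb : forall i, \int[P]_x b i x = \int[P]_x f x.
Hypothesis Ebb : forall i j, i != j ->
  \int[P]_x (b i x * b j x) = \int[P]_x (f x ^+ 2).

Let bf : bdd_mfun f. Proof. exact: bdd_mfun_01. Qed.

Lemma Rintegral_mul_centered (g h : T -> R) (c : R) : bdd_mfun g -> bdd_mfun h ->
  \int[P]_x ((g x - c) * (h x - c)) =
  \int[P]_x (g x * h x) - c * \int[P]_x g x - c * \int[P]_x h x + c ^+ 2.
Proof.
move=> bg bh.
have bc (u : T -> R) : bdd_mfun u -> bdd_mfun (fun x => c * u x).
  by move=> bu; apply: bdd_mfunM => //; exact: bdd_mfun_cst.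
have bgh : bdd_mfun (fun x => g x * h x) by exact: bdd_mfunM.
have bghg : bdd_mfun (fun x => g x * h x - c * g x).
  by apply: bdd_mfunB => //; exact: bc.
transitivity (\int[P]_x (g x * h x - c * g x - c * h x + c ^+ 2)).
  by apply: eq_Rintegral => x _; ring.
rewrite RintegralD_bdd; [|by apply: bdd_mfunB => //; exact: bc|exact: bdd_mfun_cst].
rewrite RintegralB_bdd//; last exact: bc.
rewrite RintegralB_bdd//; last exact: bc.
by rewrite (RintegralZl_bdd P c bg) (RintegralZl_bdd P c bh) Rintegral_cst_prob.
Qed.

(* Off-diagonal pairs contribute V = E (f - c)^2 and diagonal ones
   W = E (b 0 - c)^2, so the left integral is V + (W - V) / M. *)
Lemma average_variance_bound (M : nat) (c : R) : (0 < M)%N -> 0 <= c <= 1 ->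
  `|\int[P]_x ((M%:R^-1 * \sum_(i < M) b i x - c) ^+ 2) -
    \int[P]_x ((f x - c) ^+ 2)| <= M%:R^-1.
Proof.
move=> M0 c01; have MR : M%:R != 0 :> R by rewrite pnatr_eq0 -lt0n.
set V := \int[P]_x ((f x - c) ^+ 2).
pose W := \int[P]_x ((b 0 x - c) ^+ 2).
have bbc i : bdd_mfun (fun x => b i x - c).
  by apply: bdd_mfunB => //; exact: bdd_mfun_cst.
have bbcc i j : bdd_mfun (fun x => (b i x - c) * (b j x - c)) by exact: bdd_mfunM.
have VE : V = \int[P]_x (f x ^+ 2) - c * \int[P]_x f x - c * \int[P]_x f x + c ^+ 2.
  by rewrite -Rintegral_mul_centered//.
have cov i j : \int[P]_x ((b i x - c) * (b j x - c)) = V + (i == j)%:R * (W - V).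
  have [->|ij] := eqVneq i j; last first.
    by rewrite mul0r addr0 Rintegral_mul_centered// Ebb// !Eb VE.
  (* On the diagonal, idempotence gives E b_i^2 = E b_i = E f, so [W] is the same for every i. *)
  rewrite mul1r addrC subrK /W !Rintegral_mul_centered// !Eb.
  by congr (_ - _ - _ + _); under eq_Rintegral do rewrite b_idem;
    under [RHS]eq_Rintegral do rewrite b_idem; rewrite !Eb.
have -> : \int[P]_x ((M%:R^-1 * \sum_(i < M) b i x - c) ^+ 2) =
    V + M%:R^-1 * (W - V).
  transitivity (\int[P]_x (M%:R^-1 ^+ 2 *
      \sum_(i < M) \sum_(j < M) ((b i x - c) * (b j x - c)))).
    apply: eq_Rintegral => x _.
    under [in RHS]eq_bigr do rewrite -mulr_sumr.
    rewrite -mulr_suml -expr2 -exprMn sumrB sumr_const card_ord mulrBr.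
    by rewrite -(mulr_natl c) mulrA mulVf// mul1r.
  rewrite RintegralZl_bdd; last first.
    by do 2 apply: bdd_mfun_sum => ?; exact: bbcc.
  rewrite Rintegral_sum_bdd; last by move=> i; exact: bdd_mfun_sum.
  under eq_bigr do rewrite Rintegral_sum_bdd//.
  have row (i : 'I_M) :
      \sum_(j < M) \int[P]_x ((b i x - c) * (b j x - c)) = M%:R * V + (W - V).
    under eq_bigr do rewrite cov.
    rewrite big_split/= sumr_const card_ord -[V *+ M]mulr_natl -mulr_suml.
    congr (_ + _).
    rewrite (bigD1 i)//= eqxx big1 ?addr0 ?mul1r// => j ji.
    by rewrite (_ : (_ == _) = false)//; apply/negbTE; rewrite eq_sym.
  under eq_bigr do rewrite row.
  rewrite sumr_const card_ord -mulr_natl.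
  by field.
rewrite addrC addKr normrM ger0_norm ?invr_ge0// ler_piMr ?invr_ge0//.
have sq01 (h : T -> R) : bdd_mfun h -> (forall x, 0 <= h x <= 1) ->
    0 <= \int[P]_x ((h x - c) ^+ 2) <= 1.
  move=> bh h01; rewrite Rintegral_ge0/=; last by move=> x _; exact: sqr_ge0.
  rewrite -[leRHS](Rintegral_cst_prob P 1); apply: le_Rintegral_bdd.
  - by apply: bdd_mfun_sqr; apply: bdd_mfunB => //; exact: bdd_mfun_cst.
  - exact: bdd_mfun_cst.
  - move=> x; have /andP[? ?] := h01 x; have /andP[? ?] := c01.
    have u1 : 0 <= 1 - (h x - c) by lra.
    have u2 : 0 <= 1 + (h x - c) by lra.
    by have := mulr_ge0 u1 u2; rewrite -subr_sqr expr1n subr_ge0.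
have /andP[V0 V1] : 0 <= V <= 1 by exact: sq01.
have /andP[W0 W1] : 0 <= W <= 1.
  apply: sq01 => // x.
  have : b 0 x * (b 0 x - 1) == 0 by rewrite mulrBr mulr1 b_idem subrr.
  by rewrite mulf_eq0 subr_eq0 => /orP[] /eqP ->; rewrite ler01 lexx.
by rewrite ler_norml; apply/andP; split; lra.
Qed.

End averages.

(** All terms are bounded by 1, so both sides become mean-square statements, and these differ by at
    most 1/M_n. The equivalence serves both ways: from empirical measures to the kernel, and from
    the kernel to Monte Carlo p-values. *)
Lemma cvg_mean0_average (b : nat -> nat -> T -> R) (f : nat -> T -> R) (c : R)
    (Mn : nat -> nat) :
  (forall n i, bdd_mfun (b n i)) ->
  (forall n i x, b n i x * b n i x = b n i x) ->
  (forall n, measurable_fun [set: T] (f n)) ->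
  (forall n x, 0 <= f n x <= 1) ->
  (forall n i, \int[P]_x b n i x = \int[P]_x f n x) ->
  (forall n i j, i != j -> \int[P]_x (b n i x * b n j x) = \int[P]_x (f n x ^+ 2)) ->
  0 <= c <= 1 -> Mn n @[n --> \oo] --> \oo ->
  cvg_mean0 P (fun n x => (Mn n)%:R^-1 * (\sum_(i < Mn n) b n i x) - c) <->
  cvg_mean0 P (fun n x => f n x - c).
Proof.
move=> bb bi mf f01 Eb Ebb c01 Mny.
have b01 n i x : 0 <= b n i x <= 1.
  have : b n i x * (b n i x - 1) == 0 by rewrite mulrBr mulr1 bi subrr.
  by rewrite mulf_eq0 subr_eq0 => /orP[] /eqP ->; rewrite ?ler01 lexx.
have avg01 n x : 0 <= (Mn n)%:R^-1 * (\sum_(i < Mn n) b n i x) <= 1.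
  have s0 : 0 <= \sum_(i < Mn n) b n i x.
    by apply: sumr_ge0 => i _; case/andP: (b01 n i x).
  rewrite mulr_ge0 ?invr_ge0//=.
  (* Since 0^-1 = 0, the empty average is 0 and the bounds hold for every [n]. *)
  have [->|M0] := posnP (Mn n); first by rewrite invr0 mul0r.
  rewrite ler_pdivrMl ?ltr0n// mulr1.
  apply: (@le_trans _ _ (\sum_(i < Mn n) 1)); last by rewrite sumr_const card_ord.
  by apply: ler_sum => i _; case/andP: (b01 n i x).
have dist1 (u : R) : 0 <= u <= 1 -> `|u - c| <= 1.
  by move=> /andP[? ?]; have /andP[? ?] := c01; rewrite ler_norml; apply/andP; split; lra.
have bavg n : bdd_mfun (fun x => (Mn n)%:R^-1 * (\sum_(i < Mn n) b n i x) - c).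
  apply: bdd_mfunB; last exact: bdd_mfun_cst.
  apply: bdd_mfunM; first exact: bdd_mfun_cst.
  by apply: bdd_mfun_sum => i; exact: bb.
have bfc n : bdd_mfun (fun x => f n x - c).
  by apply: bdd_mfunB; [exact: bdd_mfun_01|exact: bdd_mfun_cst].
rewrite !cvg_mean0_sqr//; try by move=> n x; exact: dist1.
set U := (fun n => \int[P]_x (_ * _ - c) ^+ 2); set V := (fun n => \int[P]_x (f n x - c) ^+ 2).
have UV0 : U n - V n @[n --> \oo] --> (0 : R).
  apply/cvgrPdist_le => e e0.
  have := Mny; move/cvgnyPge => /(_ (Num.truncn e^-1).+1).
  apply: filterS => n eM; have M0 : (0 < Mn n)%N by exact: leq_trans eM.
  rewrite sub0r normrN (le_trans (average_variance_bound _ _ _ _ _ _ M0 c01))//.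
    by move=> i j; exact: Ebb.
  rewrite -[leRHS]invrK lef_pV2 ?posrE ?invr_gt0 ?ltr0n//.
  by rewrite (le_trans (ltW (truncnS_gt _)))// ler_nat.
split=> [U0|V0].
  have -> : V = fun n => U n - (U n - V n).
    by apply/funext => n; rewrite opprB addrC subrK.
  by rewrite -[X in _ --> X]subr0; exact: cvgB U0 UV0.
have -> : U = fun n => (U n - V n) + V n by apply/funext => n; rewrite subrK.
by rewrite -[X in _ --> X]addr0; exact: cvgD UV0 V0.
Qed.

End second_moments.

(** * P-values *)

Section empirical_measures.
Context {R : realType}.
Implicit Types (y : nat -> R) (M : nat) (x : R).

(** For [M = 0] both averages are 0 and the identity fails. *)
Lemma mc_pvalueE y M x : (0 < M)%N ->
  mc_pvalue y M x = 1 - empirical_cdf y M x.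
Proof.
move=> M0; rewrite /mc_pvalue /empirical_cdf.
have M1 : M%:R^-1 * \sum_(i < M) 1 = 1 :> R.
  by rewrite sumr_const card_ord mulVf// pnatr_eq0 -lt0n.
apply/eqP; rewrite eq_sym subr_eq -mulrDr -big_split/= -[X in X == _]M1.
apply/eqP; congr (_ * _); apply: eq_bigr => i _.
by rewrite ltNge; case: (_ <= _); rewrite ?add0r ?addr0.
Qed.

Lemma empirical_ray y M x :
  fine (empirical y M `]-oo, x]%classic) = empirical_cdf y M x.
Proof.
rewrite /empirical /empirical_cdf /= /mscale/= /msum.
have -> : (\sum_(i < M) \d_(y i) `]-oo, x]%classic =
    (\sum_(i < M) (y i <= x)%R%:R)%:E :> \bar R)%E.
  rewrite -sumEFin; apply: eq_bigr => i _.
  by rewrite diracE mem_setE in_itv.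
by [].
Qed.

Lemma empirical_le1 y M : (empirical y M [set: R] <= 1)%E.
Proof.
rewrite /empirical /= /mscale/= /msum.
rewrite (eq_bigr (fun=> 1%:E)); last by move=> i _; exact: diracT.
rewrite sumEFin sumr_const card_ord -EFinM lee_fin.
have [->|M0] := posnP M; first by rewrite mulr0n mulr0.
by rewrite mulVf// pnatr_eq0 -lt0n.
Qed.

Lemma mc_pvalue_nonincreasing y M : {homo mc_pvalue y M : s t / s <= t >-> t <= s}.
Proof.
move=> s t st; rewrite /mc_pvalue ler_wpM2l ?invr_ge0//; apply: ler_sum => i _.
have [ty|_] := ltP t (y i); last by [].
by rewrite (le_lt_trans st ty).
Qed.

Lemma mc_pvalue_01 y M s : 0 <= mc_pvalue y M s <= 1.
Proof.
have [->|M0] := posnP M; first by rewrite /mc_pvalue big_ord0 mulr0 lexx ler01.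
rewrite /mc_pvalue mulr_ge0 ?invr_ge0 ?sumr_ge0//=.
rewrite ler_pdivrMl ?ltr0n// mulr1.
apply: (@le_trans _ _ (\sum_(i < M) 1)); last by rewrite sumr_const card_ord.
by apply: ler_sum => i _; case: (_ < _).
Qed.

End empirical_measures.

Section replicates.
Context {R : realType} {d dX : measure_display} {Omega : measurableType d}
  {T : measurableType dX} (P : probability Omega R) (X : {RV P >-> T})
  (Y : nat -> {RV P >-> R}) (kappa : R.-pker T ~> R).
Hypothesis Y_indep : cond_independent P X Y.
Hypothesis Y_ident : cond_identically_distributed P X Y.
Hypothesis kappaY : regular_cond_distr P X (Y 0%N) kappa.

Let B x : set R := `]-oo, x]%classic.
Let h x w := fine (kappa (X w) (B x)).

Lemma cond_prob_ray i x : cond_prob P X (Y i @^-1` B x) (h x).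
Proof. have mB : measurable (B x) by exact: measurable_itv.
by have := Y_ident i mB (kappaY mB). Qed.

Lemma kernel_ray_01 x w : 0 <= h x w <= 1.
Proof.
have mB : measurable (B x) by exact: measurable_itv.
rewrite /h fine_ge0//= -lee_fin fineK; first exact: pkernel_le1.
exact: pkernel_fin_num.
Qed.

Lemma measurable_kernel_ray x : measurable_fun [set: Omega] (h x).
Proof.
by have [mh _ _] := cond_prob_ray 0 x; exact: measurable_fun_sub_preimage mh.
Qed.

Lemma measurable_fun_ray i x : measurable_fun [set: Omega] (fun w => (Y i w <= x)%R).
Proof. by apply: measurable_fun_ler => //; exact: measurable_cst. Qed.

Lemma replicate_mean i x :
  \int[P]_w (Y i w <= x)%R%:R = \int[P]_w h x w.
Proof.
rewrite Rintegral_bool; last exact: measurable_fun_ray.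
by rewrite (Rintegral_cond_prob (cond_prob_ray i x)).
Qed.

(** All replicates share the version [h x], so conditional independence of a pair gives the
    conditional probability h^2, and integrating removes the conditioning. *)
Lemma replicate_pair_mean i j x : i != j ->
  \int[P]_w ((Y i w <= x)%R%:R * (Y j w <= x)%R%:R) = \int[P]_w (h x w ^+ 2).
Proof.
move=> ij.
have := @Y_indep [fset i; j]%fset (fun=> B x) (fun=> h x) (fun=> measurable_itv _)
  (fun i => cond_prob_ray i x).
rewrite big_fsetU1/= ?inE// big_seq_fset1.
rewrite (_ : (fun w => _) = fun w => h x w ^+ 2); last first.
  by apply/funext => w; rewrite big_fsetU1/= ?inE// big_seq_fset1.
move=> /Rintegral_cond_prob ->.
under eq_Rintegral do rewrite -natrM mulnb.
rewrite Rintegral_bool.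
  congr (fine (P _)); apply/seteqP; split => w /=; rewrite /B /= !in_itv/=.
    by move/andP.
  by move=> [-> ->].
by apply: measurable_and; exact: measurable_fun_ray.
Qed.

Variables (s : {mfun T >-> R}).

(** Disintegration applied to the set of pairs with s(x) < y, whose section at x is the complement
    of the closed lower ray ending at s(x). *)
Lemma cond_prob_pvalue :
  cond_prob P X [set w | s (X w) < Y 0%N w]
    (fun w => 1 - fine (kappa (X w) `]-oo, s (X w)]%classic)).
Proof.
pose A := [set xy : T * R | s xy.1 < xy.2].
have mA : measurable A.
  rewrite -[X in measurable X]setTI.
  have m : measurable_fun [set: T * R] (fun xy => s xy.1 < xy.2).
    by apply: measurable_fun_ltr => //; exact: measurableT_comp.
  exact: (m measurableT [set true]).
have := cond_prob_kernel_xsection kappaY mA.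
congr (cond_prob _ _ _ _); apply/funext => w.
have -> : xsection A (X w) = ~` `]-oo, s (X w)]%classic.
  by apply/seteqP; split => y; rewrite /xsection /= inE /A/= in_itv/= ltNge => /negP.
have fin := pkernel_fin_num kappa (X w) (measurable_itv `]-oo, s (X w)]).
have -> : ~` `]-oo, s (X w)]%classic = [set: R] `\` `]-oo, s (X w)]%classic.
  by rewrite setTD.
have kT : kappa (X w) [set: R] = 1%E by exact: prob_kernel.
rewrite measureD//; last by rewrite [X in (X < _)%E]kT ltry.
by rewrite setTI [X in (X - _)%E]kT fineB.
Qed.

End replicates.

(* The replicate numbered i + 1 is [Sb n i]. *)
Theorem corollary4p3
  (R : realType)
  (d : measure_display) (Omega : measurableType d) (P : probability Omega R)
  (dX : nat -> measure_display) (XX : forall n, measurableType (dX n))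
  (dW : nat -> measure_display) (WW : forall n, measurableType (dW n))
  (X : forall n, {RV P >-> XX n})
  (s : forall n, {mfun XX n >-> R})
  (S_ : nat -> {RV P >-> R})
  (S_def : forall n w, S_ n w = s n (X n w))
  (W : forall n, nat -> {RV P >-> WW n})
  (W_ident : forall n i j (A : set (WW n)), measurable A ->
     distribution P (W n i) A = distribution P (W n j) A)
  (sb : forall n, nat -> {mfun (XX n * WW n)%type >-> R})
  (Sb : nat -> nat -> {RV P >-> R})
  (Sb_def : forall n i w, Sb n i w = sb n i (X n w, W n i w))
  (Sb_indep : forall n, cond_independent P (X n) (Sb n))
  (Sb_ident : forall n, cond_identically_distributed P (X n) (Sb n))
  (kappa : forall n, R.-pker XX n ~> R)
  (kappa_regular : forall n, regular_cond_distr P (X n) (Sb n 0%N) (kappa n))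
  (d' : measure_display) (Omega' : measurableType d') (P' : probability Omega' R)
  (Sinf : {RV P' >-> R})
  (Sinf_cont : continuous (fun x : R => fine (cdf Sinf x)))
  (S_cvg : weak_cvg P S_ (distribution P' Sinf))
  (consistency :
     [\/ weak_cvg_tuple P (fun n w => [tuple S_ n w; Sb n 0%N w; Sb n 1%N w])
           (power_prob (distribution P' Sinf) 3),
         forall M : nat, (2 <= M)%N ->
           weak_cvg_tuple P
             (fun n w => [tuple of S_ n w :: [tuple Sb n i w | i < M]])
             (power_prob (distribution P' Sinf) M.+1),
         cvg_prob0 P \oo (fun n w =>
           d_BL (kappa n (X n w)) (distribution P (S_ n))) |
      [\/ cvg_prob0 P (filter_prod \oo \oo) (fun (nM : nat * nat) w =>
            d_BL (empirical (fun i => Sb nM.1 i w) nM.2) (distribution P (S_ nM.1))),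
          cvg_prob0 P \oo (fun n w =>
            d_K (kappa n (X n w)) (distribution P (S_ n))) |
          cvg_prob0 P (filter_prod \oo \oo) (fun (nM : nat * nat) w =>
            d_K (empirical (fun i => Sb nM.1 i w) nM.2) (distribution P (S_ nM.1)))]])
  (p : nat -> Omega -> R)
  (p_def : forall n, cond_prob P (X n) [set w | S_ n w < Sb n 0%N w] (p n)) :
  [/\ forall n M w, (0 < M)%N ->
        mc_pvalue (fun i => Sb n i w) M (S_ n w) =
        1 - empirical_cdf (fun i => Sb n i w) M (S_ n w),
      forall n, {ae P, forall w,
        p n w = 1 - fine (kappa n (X n w) `]-oo, S_ n w]%classic)},
      weak_cvg P p uniform01 &
      forall Mn : nat -> nat, Mn n @[n --> \oo] --> \oo ->
        weak_cvg P (fun n w => mc_pvalue (fun i => Sb n i w) (Mn n) (S_ n w))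
          uniform01].
Proof.
pose F x := fine (cdf Sinf x).
have F01 x : 0 <= F x <= 1 by exact: fine_cdf_01.
pose f n x w := fine (kappa n (X n w) `]-oo, x]%classic).
pose b x n i w : R := (Sb n i w <= x)%R%:R.
have mf n x : measurable_fun [set: Omega] (f n x).
  exact: measurable_kernel_ray (Sb_ident n) (kappa_regular n) x.
have f01 n x w : 0 <= f n x w <= 1 by exact: kernel_ray_01.
have bdb x n i : bdd_mfun (b x n i).
  by apply: bdd_mfun_bool; exact: measurable_fun_ray.
have b_idem x n i w : b x n i w * b x n i w = b x n i w.
  by rewrite /b -natrM mulnb andbb.
have Eb x n i : \int[P]_w b x n i w = \int[P]_w f n x w.
  exact: replicate_mean (Sb_ident n) (kappa_regular n) i x.
have Ebb x n i j : i != j ->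
    \int[P]_w (b x n i w * b x n j w) = \int[P]_w (f n x w ^+ 2).
  exact: replicate_pair_mean (Sb_indep n) (Sb_ident n) (kappa_regular n) i j x.
have average x Mn := cvg_mean0_average (Mn := Mn) (bdb x) (b_idem x)
  (fun n => mf n x) (fun n => f01 n x) (Eb x) (Ebb x) (F01 x).
have triple_cvg :
    weak_cvg_tuple P (fun n w => [tuple S_ n w; Sb n 0%N w; Sb n 1%N w])
      (power_prob (distribution P' Sinf) 3) ->
    forall x, cvg_mean0 P (fun n w => f n x w - F x).
  move=> tri x.
  have mY n : measurable_fun [set: Omega]
      (fun w => [tuple S_ n w; Sb n 0%N w; Sb n 1%N w]).
    by do 3 (apply: measurable_cons => //).
  have lim (A : {set 'I_3}) :
      \int[P]_w (\prod_(i in A)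
        (tnth [tuple S_ n w; Sb n 0%N w; Sb n 1%N w] i <= x)%R%:R) @[n --> \oo] -->
      F x ^+ #|A|.
    exact: cvg_joint_cdf.
  have lim1 : \int[P]_w f n x w @[n --> \oo] --> F x.
    (* Coordinate 0 is the statistic; coordinates 1 and 2 are the replicates 0 and 1. *)
    have := lim [set inord 1]%SET; rewrite cards1 expr1; apply: cvg_trans.
    apply: near_eq_cvg; apply: nearW => n.
    rewrite -(Eb x n 0%N); apply: eq_Rintegral => w _.
    by rewrite big_set1 /b (tnth_nth 0) inordK.
  have lim2 : \int[P]_w (f n x w ^+ 2) @[n --> \oo] --> F x ^+ 2.
    have I12 : (inord 1 : 'I_3) \notin [set inord 2]%SET.
      by rewrite inE -val_eqE /= !inordK.
    have := lim (inord 1 |: [set inord 2])%SET; rewrite cardsU1 I12 cards1.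
    apply: cvg_trans; apply: near_eq_cvg; apply: nearW => n.
    rewrite -(@Ebb x n 0%N 1%N)//; apply: eq_Rintegral => w _.
    by rewrite big_setU1//= big_set1 /b !(tnth_nth 0) !inordK.
  apply/cvg_mean0_sqr => [n|n w|].
  - by apply: bdd_mfunB; [exact: bdd_mfun_01|exact: bdd_mfun_cst].
  - have /andP[? ?] := f01 n x w; have /andP[? ?] := F01 x.
    by rewrite ler_norml; apply/andP; split; lra.
  (* With E F_n tending to F and E F_n^2 to F^2, the expanded square tends to F^2 - 2 F^2 + F^2 =
     0. *)
  have -> : (fun n => \int[P]_w ((f n x w - F x) ^+ 2)) =
      fun n => \int[P]_w (f n x w ^+ 2) - F x * \int[P]_w f n x w -
        F x * \int[P]_w f n x w + F x ^+ 2.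
    apply/funext => n; rewrite -Rintegral_mul_centered//; exact: bdd_mfun_01.
  have -> : (0 : R) = F x ^+ 2 - F x * F x - F x * F x + F x ^+ 2 by ring.
  apply: cvgD; last exact: cvg_cst.
  by do 2 (apply: cvgB; last by apply: cvgM => //; exact: cvg_cst).
(* Only the diagonal M = n of the double limit is needed. *)
have emp_cvg (x : R) : cvg_mean0 P
      (fun n w => fine (empirical (fun i => Sb n i w) n `]-oo, x]%classic) - F x) ->
    cvg_mean0 P (fun n w => f n x w - F x).
  move=> H; apply/(average x id) => //; apply: cvg_trans H.
  apply: near_eq_cvg; apply: nearW => n; apply: eq_Rintegral => w _.
  by rewrite empirical_ray.
have memp n x : measurable_fun [set: Omega]
    (fun w => fine (empirical (fun i => Sb n i w) n `]-oo, x]%classic)).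
  under eq_fun do rewrite empirical_ray /empirical_cdf.
  have [] // : bdd_mfun (fun w => n%:R^-1 * \sum_(i < n) b x n i w).
  by apply: bdd_mfunM; [exact: bdd_mfun_cst|exact: bdd_mfun_sum].
have diag (D : nat * nat -> Omega -> \bar R) :
    cvg_prob0 P (filter_prod \oo \oo) D -> cvg_prob0 P \oo (fun n => D (n, n)).
  move=> D0 e e0; apply: cvg_comp (D0 e e0).
  move=> U [[A B] [/= NA NB] AB]; apply: filterS2 NA NB => n An Bn.
  exact: (AB (n, n)).
have cdf_cvg x : cvg_mean0 P (fun n w => f n x w - F x).
  have kernel1 n w : (kappa n (X n w) [set: R] <= 1)%E by exact: pkernel_le1.
  case: consistency => [|/(_ 2%N isT) tri|D0|[/diag D0|D0|/diag D0]].
  - by move/triple_cvg.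
  - apply: triple_cvg; suff <- : (fun n w =>
        [tuple of S_ n w :: [tuple Sb n i w | i < 2]]) =
        (fun n w => [tuple S_ n w; Sb n 0%N w; Sb n 1%N w]) by [].
    apply/funext => n; apply/funext => w; apply: val_inj => /=; congr (_ :: _).
    by rewrite [LHS](map_comp (fun i => Sb n i w) (@nat_of_ord 2)) val_enum_ord.
  - exact: (cvg_mean0_cdf_of_d_BL Sinf_cont S_cvg kernel1 mf D0).
  - apply: emp_cvg.
    exact: (cvg_mean0_cdf_of_d_BL Sinf_cont S_cvg (fun n w => empirical_le1 _ n) memp D0).
  - exact: (cvg_mean0_cdf_of_d_K Sinf_cont S_cvg kernel1 mf D0).
  - apply: emp_cvg.
    exact: (cvg_mean0_cdf_of_d_K Sinf_cont S_cvg (fun n w => empirical_le1 _ n) memp D0).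
(* [q] is the version supplied by the kernel. The given [p] agrees with it almost surely, which is
   enough since weak convergence only sees integrals. *)
pose q n w := 1 - fine (kappa n (X n w) `]-oo, S_ n w]%classic).
have qE n : cond_prob P (X n) [set w | S_ n w < Sb n 0%N w] (q n).
  have := cond_prob_pvalue (kappa_regular n) (s n).
  congr (cond_prob _ _ _ _); first by apply/funext => w /=; rewrite S_def.
  by apply/funext => w; rewrite /q S_def.
have pq n : {ae P, forall w, p n w = q n w}.
  apply: cond_prob_ae_eq (p_def n) (qE n).
  have m : measurable_fun [set: Omega] (fun w => S_ n w < Sb n 0%N w).
    exact: measurable_fun_ltr.
  by rewrite -[X in measurable X]setTI; exact: (m measurableT [set true]).
have mq n : measurable_fun [set: Omega] (q n).
  by have [m _ _] := qE n; exact: measurable_fun_sub_preimage m.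
split => //.
- by move=> n M w; exact: mc_pvalueE.
- have q_cvg : weak_cvg P q uniform01.
    apply: (weak_cvg_survival_uniform01 (H := fun n w x => 1 - f n x w)
      Sinf_cont S_cvg) => // [n w x|n w x y xy|n x|x].
    + by have /andP[? ?] := f01 n x w; apply/andP; split; lra.
    + rewrite lerD2l lerN2 /f fine_le ?pkernel_fin_num//.
      by rewrite le_measure ?inE//; exact: subset_itvl.
    + by apply: measurable_funB => //; exact: measurable_cst.
    + apply: cvg_trans (cdf_cvg x); apply: near_eq_cvg; apply: nearW => n.
      apply: eq_Rintegral => w _; rewrite -[RHS]normrN; congr `|_|.
      by rewrite -/(F x); ring.
  move=> g cg bg; apply: cvg_trans (q_cvg g cg bg).
  apply: near_eq_cvg; apply: nearW => n.
  have mg : measurable_fun [set: R] g by exact: continuous_measurable_fun.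
  apply: ae_eq_integral => //.
  + by apply/measurable_EFinP; exact: (measurableT_comp mg).
  + have [mp _ _] := p_def n.
    apply/measurable_EFinP; apply: (measurableT_comp mg).
    exact: measurable_fun_sub_preimage mp.
  + by apply: filterS (pq n) => w -> _.
- move=> Mn Mny.
  have mpv n (Z : Omega -> R) : measurable_fun [set: Omega] Z ->
      measurable_fun [set: Omega]
        (fun w => mc_pvalue (fun i => Sb n i w) (Mn n) (Z w)).
    move=> mZ; suff [mz _] : bdd_mfun
        (fun w => (Mn n)%:R^-1 * \sum_(i < Mn n) (Z w < Sb n i w)%R%:R : R).
      exact: mz.
    apply: bdd_mfunM; first exact: bdd_mfun_cst.
    by apply: bdd_mfun_sum => i; apply: bdd_mfun_bool; exact: measurable_fun_ltr.
  apply: (weak_cvg_survival_uniform01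
    (H := fun n w x => mc_pvalue (fun i => Sb n i w) (Mn n) x)
    Sinf_cont S_cvg) => // [n w x|n w x y|n x|n|x].
  + exact: mc_pvalue_01.
  + exact: mc_pvalue_nonincreasing.
  + by apply: mpv; exact: measurable_cst.
  + exact: mpv.
  have /(average x Mn Mny) := cdf_cvg x.
  apply: cvg_trans; apply: near_eq_cvg.
  (* The identity between p-value and empirical distribution function requires M_n >= 1, which holds
     eventually. *)
  have := Mny; move/cvgnyPge => /(_ 1%N); apply: filterS => n M1.
  apply: eq_Rintegral => w _; rewrite mc_pvalueE// -[RHS]normrN; congr `|_|.
  by rewrite /empirical_cdf -/(F x); ring.
Qed.
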